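(* Let $I$ be the interval $[0,1]$ or the circle $\mathbb{T}^1$, let $r>1$ be a real number and let $f:I\to I$ be a topologically transitive $\mathcal{C}^r$ map. Then there is at most one hyperbolic $f$-invariant Borel probability measure on $I$ that is absolutely continuous with respect to the Lebesgue measure; moreover, if such a measure exists, it is ergodic.
   Context: For real $r>1$, $f$ is $\mathcal{C}^r$ if it is $\mathcal{C}^{\lfloor r\rfloor}$ and its $\lfloor r\rfloor$-th derivative is Hölder with exponent $r-\lfloor r\rfloor$ (no extra condition if $r$ is an integer). The Lyapunov exponent at $x$ is $\chi(x)=\limsup_{n\to+\infty}\frac1n\log|(f^n)'(x)|$ (with $\log0=-\infty$), and an $f$-invariant probability $\mu$ is hyperbolic if $\chi>0$ $\mu$-almost everywhere. Topologically transitive means that for all nonempty open $U,V\subset I$ there is $n\ge 0$ with $f^n(U)\cap V\neq\emptyset$. *)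

(* Defs.v *)
From HB Require Import structures.
From mathcomp Require Import all_boot all_order all_algebra.
From mathcomp Require Import archimedean generic_quotient.
From mathcomp Require Import all_classical all_reals all_analysis.

Set Implicit Arguments.
Unset Strict Implicit.
Unset Printing Implicit Defensive.
Import Order.TTheory GRing.Theory Num.Theory.
Import numFieldNormedType.Exports.

Local Open Scope classical_set_scope.
Local Open Scope ring_scope.
Local Open Scope quotient_scope.

(** The interval [0, 1], with the subspace topology of [R]. *)
Definition unit_interval (R : realType) : Type := set_type `[0%R : R, 1%R].

Section unit_interval_structure.
Variable R : realType.

HB.instance Definition _ := Choice.on (unit_interval R).
HB.instance Definition _ :=
  Topological.copy (unit_interval R) (set_type `[0%R : R, 1%R]).

Lemma unit_interval0 : (0 : R) \in `[0%R : R, 1%R]%classic.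
Proof. by rewrite inE /= in_itv /= lexx ler01. Qed.

HB.instance Definition _ := isPointed.Build (unit_interval R)
  (exist (fun x : R => x \in `[0, 1]%classic) 0 unit_interval0).

End unit_interval_structure.

(** The circle R / Z, with the quotient topology. *)
Section circle.
Variable R : realType.

Definition int_cong (x y : R) : bool := (x - y) \is a Num.int.

Lemma int_cong_refl : reflexive int_cong.
Proof. by move=> x; rewrite /int_cong subrr rpred0. Qed.

Lemma int_cong_sym : symmetric int_cong.
Proof. by move=> x y; rewrite /int_cong -rpredN opprB. Qed.

Lemma int_cong_trans : transitive int_cong.
Proof.
move=> y x z; rewrite /int_cong => xy yz.
by rewrite -(subrKA y) rpredD.
Qed.

Canonical int_cong_equiv := EquivRel int_cong
  int_cong_refl int_cong_sym int_cong_trans.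

Definition circle : Type := quotient_topology {eq_quot int_cong}.

HB.instance Definition _ :=
  PointedTopological.copy circle (quotient_topology {eq_quot int_cong}).

Definition circle_proj (x : R) : circle := \pi_({eq_quot int_cong}) x.

End circle.

(** The two possible phase spaces are treated uniformly: each is the image of
    a domain [chart_dom I] of [R] under [chart I]; on [0, 1] this is the
    identity, on the circle it is the projection R -> R / Z. *)
Variant phase_space := IntervalSpace | CircleSpace.

Section phase_space_theory.
Variables (R : realType) (I : phase_space).

Definition carrier : ptopologicalType :=
  match I with
  | IntervalSpace => unit_interval R : ptopologicalType
  | CircleSpace => circle R : ptopologicalType
  end.

Definition chart_dom : set R :=
  match I with
  | IntervalSpace => `[0%R, 1%R]
  | CircleSpace => [set: R]
  end.

(* On the interval, the value outside [0, 1] is junk. *)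
Definition chart : R -> carrier :=
  match I return R -> match I with
                      | IntervalSpace => unit_interval R : ptopologicalType
                      | CircleSpace => circle R : ptopologicalType
                      end with
  | IntervalSpace => fun x => insubd (point : unit_interval R) x
  | CircleSpace => @circle_proj R
  end.

Definition borel : Type := g_sigma_algebraType (@open carrier).

HB.instance Definition _ :=
  Measurable.copy borel (g_sigma_algebraType (@open carrier)).

(* The image under the chart of the Lebesgue measure of [0, 1]; on the circle
   the two endpoints are identified, but they have measure zero. *)
Definition lebesgue (A : set borel) : \bar R :=
  lebesgue_measure (`[0%R : R, 1%R]%classic `&` chart @^-1` A).

(** Derivatives relative to a set [D]: at an endpoint of [0, 1] they are
    one-sided, and for [D = setT] they are the usual derivatives. *)
Definition diff_quot (G : R -> R) (x y : R) : R := (G y - G x) / (y - x).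

Definition derivable_in (D : set R) (G : R -> R) (x : R) : Prop :=
  cvg (diff_quot G x @ within D x^').

Definition derive_in (D : set R) (G : R -> R) (x : R) : R :=
  lim (diff_quot G x @ within D x^').

Definition derive_in_n (D : set R) (n : nat) (G : R -> R) : R -> R :=
  iter n (derive_in D) G.

Definition Ck_on (D : set R) (k : nat) (G : R -> R) : Prop :=
  (forall i x, (i < k)%N -> D x -> derivable_in D (derive_in_n D i G) x) /\
  {within D, continuous (derive_in_n D k G)}.

Definition hoelder_on (D : set R) (a : R) (G : R -> R) : Prop :=
  exists C : R, forall x y, D x -> D y -> `|G x - G y| <= C * `|x - y| `^ a.

Definition Cr_on (D : set R) (r : R) (G : R -> R) : Prop :=
  let k := Num.truncn r in
  Ck_on D k G /\
  (r \isn't a Num.int -> hoelder_on D (r - k%:R) (derive_in_n D k G)).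

(* On the circle, the continuous lifts of a map to R, unique up to an
   integer constant; on the interval, the map itself read in R. *)
Definition is_lift (g : carrier -> carrier) (G : R -> R) : Prop :=
  {within chart_dom, continuous G} /\
  forall x, chart_dom x -> chart_dom (G x) /\ chart (G x) = g (chart x).

Definition Cr_map (r : R) (f : carrier -> carrier) : Prop :=
  exists G, is_lift f G /\ Cr_on chart_dom r G.

Definition coord (t : carrier) : R :=
  get [set x | chart_dom x /\ chart x = t].

(* For a differentiable [g] this depends neither on the lift nor on the
   representative of [t]. *)
Definition deriv (g : carrier -> carrier) (t : carrier) : R :=
  derive_in chart_dom (get [set G | is_lift g G]) (coord t).

(* [lne 0 = -oo]. *)
Definition lyapunov (f : carrier -> carrier) (t : carrier) : \bar R :=
  limn_esup (fun n : nat =>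
    ((n%:R^-1 : R)%:E * lne (`|deriv (iter n f) t|%:E))%E).

Definition topologically_transitive (f : carrier -> carrier) : Prop :=
  forall U V : set carrier, open U -> open V -> U !=set0 -> V !=set0 ->
    exists n : nat, (iter n f @` U) `&` V !=set0.

Definition invariant_measure (f : carrier -> carrier) (mu : probability borel R) :=
  forall A : set borel, measurable A -> mu (f @^-1` A) = mu A.

Definition hyperbolic (f : carrier -> carrier) (mu : probability borel R) :=
  {ae mu, forall x : borel, (0 < lyapunov f x)%E}.

Definition ergodic (f : carrier -> carrier) (mu : probability borel R) :=
  forall A : set borel, measurable A -> f @^-1` A = A ->
    mu A = 0%E \/ mu A = 1%E.

Definition hyperbolic_acim (f : carrier -> carrier)
    (mu : probability borel R) : Prop :=
  [/\ invariant_measure f mu, hyperbolic f mu & mu `<< lebesgue].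

End phase_space_theory.

(* Main.v *)
(** Proof idea. Let [mu] be a hyperbolic acim and [A] a forward invariant set
    with [0 < mu A]. The maximal ergodic inequality, applied to truncations of
    [log |f'|] on the part of [A] where the derivative grows exponentially,
    shows that [log |f'|] is integrable there with positive integral. Pliss'
    lemma, applied to [log |f'|] with a large penalty on its very negative
    part, then yields a set of positive measure of points with infinitely many
    times [n] at which both [|(f^k)'|] at [f^(n - k) x] is at least [e^(k s)]
    and [|f'|] at [f^(n - k) x] is at least [e^(- K - k e)], for all [k <= n].
    Since [f'] is Hoelder continuous, at such a time [f^n] has bounded
    distortion on an interval around [x] that it maps onto an interval of a
    fixed size. Taking [x] a Lebesgue density point of [A], these images show
    that [A] has full Lebesgue measure in some nondegenerate interval. By
    transitivity two disjoint forward invariant sets cannot both have this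
    property, which gives ergodicity; uniqueness follows in the same way, with
    the forward invariant sets extracted from a Hahn decomposition of the
    difference of the two measures.

    On [0, 1] the map is first extended affinely outside the interval, so that
    the endpoints need no special care in the distortion estimate. *)

Require Import Defs.
From mathcomp Require Import all_boot all_order all_algebra.
From mathcomp Require Import generic_quotient.
From mathcomp Require Import all_classical all_reals all_analysis.
From mathcomp Require Import measurable_realfun.
From mathcomp Require Import lra ring zify.

Set Implicit Arguments.
Unset Strict Implicit.
Unset Printing Implicit Defensive.
Import Order.TTheory GRing.Theory Num.Theory.
Import numFieldNormedType.Exports.

Local Open Scope classical_set_scope.
Local Open Scope ring_scope.
Local Open Scope quotient_scope.

(** * Birkhoff sums and hyperbolic times *)

Section birkhoff_sums.
Context {R : realType} {T : Type} (f : T -> T).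

Definition birkhoff (h : T -> R) (n : nat) (x : T) : R :=
  \sum_(i < n) h (iter i f x).

Lemma birkhoff0 h x : birkhoff h 0 x = 0.
Proof. by rewrite /birkhoff big_ord0. Qed.

Lemma birkhoffS h n x : birkhoff h n.+1 x = birkhoff h n x + h (iter n f x).
Proof. by rewrite /birkhoff big_ord_recr. Qed.

Lemma birkhoffSl h n x : birkhoff h n.+1 x = h x + birkhoff h n (f x).
Proof.
rewrite /birkhoff big_ord_recl /=; congr (_ + _).
by apply: eq_bigr => i _; rewrite -iterSr.
Qed.

Lemma birkhoffD_n h m n x :
  birkhoff h (m + n) x = birkhoff h m x + birkhoff h n (iter m f x).
Proof.
elim: n => [|n IH]; first by rewrite addn0 birkhoff0 addr0.
by rewrite addnS !birkhoffS IH -addrA -iterD addnC.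
Qed.

Definition record (b : T -> R) (n : nat) (x : T) : bool :=
  [forall j : 'I_n.+1, birkhoff b j x <= birkhoff b n x].

(** A difference of two partial sums is a sum over a later stretch of the orbit, so at a record
    every sum over the last [k] steps is nonnegative; hyperbolic times concern exactly such final
    segments. *)
Lemma recordP b n x :
  reflect (forall k, (k <= n)%N -> 0 <= birkhoff b k (iter (n - k) f x))
          (record b n x).
Proof.
apply: (iffP forallP) => [H k kn|H j].
  have := H (inord (n - k)); rewrite inordK ?ltnS ?leq_subr//.
  by rewrite -{2}(subnK kn) birkhoffD_n lerDl.
have jn : (j <= n)%N by rewrite -ltnS.
have := H _ (leq_subr j n).
have -> : birkhoff b n x = birkhoff b (j + (n - j)) x by rewrite subnKC.
by rewrite subKn // birkhoffD_n lerDl.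
Qed.

(* The running maximum of the partial sums only increases at a record, and
   then by at most [M] (Pliss' lemma). *)
Lemma pliss b (M : R) N x : 0 <= M -> (forall y, b y <= M) ->
  birkhoff b N x <= M * \sum_(n < N) (record b n.+1 x)%:R.
Proof.
move=> M0 bM.
suff H j : (j <= N)%N ->
    birkhoff b j x <= M * \sum_(n < N) (record b n.+1 x)%:R by exact: H.
elim: N j => [|N IH] j.
  by rewrite leqn0 => /eqP ->; rewrite birkhoff0 big_ord0 mulr0.
have H0 i : (i <= N)%N ->
    birkhoff b i x <= M * \sum_(n < N.+1) (record b n.+1 x)%:R.
  move=> iN; rewrite big_ord_recr/= mulrDr (le_trans (IH _ iN))//.
  by rewrite lerDl mulr_ge0.
rewrite leq_eqVlt ltnS => /predU1P[->|]; last exact: H0.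
case: (boolP (record b N.+1 x)) => [rec|/forallPn[i]].
  rewrite birkhoffS big_ord_recr/= rec mulrDr mulr1 lerD ?IH//.
rewrite -ltNge => Ni; apply: (le_trans (ltW Ni)); apply: H0.
move: (ltn_ord i); rewrite ltnS leq_eqVlt => /predU1P[iE|]; last by rewrite ltnS.
by rewrite iE ltxx in Ni.
Qed.

Definition orbit_product (g : T -> R) (n : nat) (x : T) : R :=
  \prod_(i < n) g (iter i f x).

Lemma orbit_productS g n x :
  orbit_product g n.+1 x = g x * orbit_product g n (f x).
Proof.
rewrite /orbit_product big_ord_recl /=; congr (_ * _).
by apply: eq_bigr => i _; rewrite -iterSr.
Qed.

Lemma orbit_productD g m n x : orbit_product g (m + n) x =
  orbit_product g m x * orbit_product g n (iter m f x).
Proof.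
elim: n => [|n IH]; first by rewrite addn0 /orbit_product big_ord0 mulr1.
by rewrite addnS /orbit_product !big_ord_recr /= -!/(orbit_product _ _ _) IH
  -mulrA -iterD addnC.
Qed.

(** The first condition is expansion along every final segment of the orbit. The second limits how
    close the orbit may come to the zeros of [g], more strictly as time [n] approaches. *)
Definition hyperbolic_time (g : T -> R) (s e K : R) (n : nat) : set T :=
  [set x | forall k, (0 < k <= n)%N ->
    expR (k%:R * s) <= orbit_product g k (iter (n - k) f x) /\
    expR (- K - k%:R * e) <= g (iter (n - k) f x)].

End birkhoff_sums.

(** * Integration against an invariant measure *)

Section invariant_integrals.
Context d {T : measurableType d} {R : realType}
  (m : {finite_measure set T -> \bar R}) (f : T -> T).
Hypothesis mf : measurable_fun [set: T] f.
Hypothesis finv : forall A : set T, measurable A -> m (f @^-1` A) = m A.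

(** A class closed under all the operations below and integrable for any finite measure, so that the
    integral is linear on it without side conditions. *)
Definition bmeasurable (h : T -> R) :=
  measurable_fun [set: T] h /\ exists C : R, forall x, `|h x| <= C.

Lemma bmeasurable_integrable h : bmeasurable h ->
  m.-integrable [set: T] (EFin \o h).
Proof.
move=> [mh [C hC]]; apply: measurable_bounded_integrable => //.
  by rewrite ltey_eq fin_num_measure.
by exists C; split; rewrite ?num_real// => M CM x _ /=; rewrite (le_trans (hC x))// ltW.
Qed.

Lemma bmeasurable_cst c : bmeasurable (fun=> c).
Proof. by split; [exact: measurable_cst|exists `|c|]. Qed.

Lemma bmeasurableD g h : bmeasurable g -> bmeasurable h ->
  bmeasurable (fun x => g x + h x).
Proof.
move=> [mg [C gC]] [mh [D hD]]; split; first exact: measurable_funD.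
by exists (C + D) => x; rewrite (le_trans (ler_normD _ _))// lerD.
Qed.

Lemma bmeasurableZ c h : bmeasurable h -> bmeasurable (fun x => c * h x).
Proof.
move=> [mh [C hC]]; split; first exact: measurable_funM.
by exists (`|c| * C) => x; rewrite normrM ler_wpM2l.
Qed.

Lemma bmeasurableB g h : bmeasurable g -> bmeasurable h ->
  bmeasurable (fun x => g x - h x).
Proof.
move=> mg mh; have := bmeasurableD mg (bmeasurableZ (-1) mh).
by under [X in bmeasurable X]eq_fun do rewrite mulN1r.
Qed.

Lemma measurable_iter n : measurable_fun [set: T] (iter n f).
Proof.
elim: n => [|n IH]; first exact: measurable_id.
by rewrite (_ : iter n.+1 f = f \o iter n f)//; exact: measurableT_comp.
Qed.

Lemma bmeasurable_comp h g : measurable_fun [set: T] g ->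
  bmeasurable h -> bmeasurable (h \o g).
Proof.
by move=> mg [mh [C hC]]; split; [exact: measurableT_comp|exists C => x; exact: hC].
Qed.

Lemma bmeasurable_birkhoff h n : bmeasurable h -> bmeasurable (birkhoff f h n).
Proof.
move=> bh; elim: n => [|n IH].
  rewrite (_ : birkhoff f h 0 = cst 0); first exact: bmeasurable_cst.
  by apply/funext => x; rewrite birkhoff0.
rewrite (_ : birkhoff f h n.+1 = fun x => birkhoff f h n x + h (iter n f x)).
  apply: bmeasurableD => //; apply: (@bmeasurable_comp h (iter n f)) => //.
  exact: measurable_iter.
by apply/funext => x; rewrite birkhoffS.
Qed.

Local Notation Int h := (\int[m]_x h x)%R.

Lemma Int_comp h : bmeasurable h -> Int (fun x => h (f x)) = Int h.
Proof.
move=> bh; rewrite /Rintegral; congr fine.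
have mh : measurable_fun [set: T] (EFin \o h) by apply/measurable_EFinP; case: bh.
have ih := bmeasurable_integrable (bmeasurable_comp mf bh).
have := @integral_pushforward _ _ _ _ _ f mf m setT (EFin \o h) mh.
rewrite preimage_setT => /(_ ih measurableT) /= <-.
by apply: eq_measure_integral => A mA _; exact: finv.
Qed.

Lemma Int_iter h n : bmeasurable h -> Int (fun x => h (iter n f x)) = Int h.
Proof.
move=> bh; elim: n => // n <-; under eq_Rintegral do rewrite iterSr.
apply: (@Int_comp (fun x => h (iter n f x))).
by apply: (@bmeasurable_comp h (iter n f)) => //; exact: measurable_iter.
Qed.

Lemma IntD g h : bmeasurable g -> bmeasurable h ->
  Int (fun x => g x + h x) = Int g + Int h.
Proof. by move=> bg bh; apply: RintegralD => //; exact: bmeasurable_integrable. Qed.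

Lemma IntB g h : bmeasurable g -> bmeasurable h ->
  Int (fun x => g x - h x) = Int g - Int h.
Proof. by move=> bg bh; apply: RintegralB => //; exact: bmeasurable_integrable. Qed.

Lemma IntZ c h : bmeasurable h -> Int (fun x => c * h x) = c * Int h.
Proof. by move=> bh; apply: RintegralZl => //; exact: bmeasurable_integrable. Qed.

Lemma le_Int g h : bmeasurable g -> bmeasurable h ->
  (forall x, g x <= h x) -> Int g <= Int h.
Proof. by move=> bg bh gh; apply: le_Rintegral => //; exact: bmeasurable_integrable. Qed.

Lemma Int_birkhoff h n : bmeasurable h -> Int (birkhoff f h n) = n%:R * Int h.
Proof.
move=> bh; elim: n => [|n IH].
  under eq_Rintegral do rewrite birkhoff0.
  by rewrite Rintegral_cst// !mul0r.
under eq_Rintegral do rewrite birkhoffS.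
rewrite IntD ?IH ?Int_iter//.
- by rewrite -natr1 mulrDl mul1r.
- exact: bmeasurable_birkhoff.
- by apply: (@bmeasurable_comp h (iter n f)) => //; exact: measurable_iter.
Qed.

Lemma bmeasurable_indic A : measurable A -> bmeasurable (\1_A : T -> R).
Proof.
move=> mA; split; first exact: measurable_indic.
by exists 1 => x; rewrite indicE; case: (_ \in _); rewrite ?normr1 ?normr0.
Qed.

Lemma Int_indic A : measurable A -> Int (\1_A : T -> R) = fine (m A).
Proof. by move=> mA; rewrite /Rintegral integral_indic// setIT. Qed.

Lemma Int_cst c : Int (fun=> c) = c * fine (m setT).
Proof. exact: Rintegral_cst. Qed.

(** The largest partial sum over at most [n] steps, the empty sum included; the recursion peels off
    the first point because the ergodic inequality compares the values at [x] and [f x]. *)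
Fixpoint running_max (h : T -> R) (n : nat) (x : T) : R :=
  if n is n.+1 then Num.max 0 (h x + running_max h n (f x)) else 0.

Lemma running_max_ge0 h n x : 0 <= running_max h n x.
Proof. by case: n => //= n; rewrite le_max lexx. Qed.

Lemma running_maxS h n x : running_max h n x <= running_max h n.+1 x.
Proof.
elim: n x => [|n IH] x; first exact: running_max_ge0.
by rewrite /= ge_max le_max lexx /= le_max lerD2l IH orbT.
Qed.

Lemma birkhoff_running_max h n x : birkhoff f h n x <= running_max h n x.
Proof.
elim: n x => [|n IH] x; first by rewrite birkhoff0.
by rewrite birkhoffSl /= le_max lerD2l IH orbT.
Qed.

Lemma bmeasurable_max g h : bmeasurable g -> bmeasurable h ->
  bmeasurable (fun x => Num.max (g x) (h x)).
Proof.
move=> [mg [C gC]] [mh [D hD]]; split; first exact: measurable_maxr.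
exists (C + D) => x; have C0 := le_trans (normr_ge0 _) (gC x).
have D0 := le_trans (normr_ge0 _) (hD x).
have := gC x; have := hD x; rewrite /= !ler_norml.
move=> /andP[h1 h2] /andP[g1 g2]; rewrite le_max ge_max.
by apply/andP; split; [apply/orP; left|apply/andP; split]; lra.
Qed.

Lemma bmeasurable_running_max h n : bmeasurable h -> bmeasurable (running_max h n).
Proof.
move=> bh; elim: n => [|n IH]; first exact: bmeasurable_cst.
apply: bmeasurable_max; first exact: bmeasurable_cst.
by apply: bmeasurableD => //; exact: (bmeasurable_comp mf IH).
Qed.

Lemma measurable_ler_set (g h : T -> R) : measurable_fun [set: T] g ->
  measurable_fun [set: T] h -> measurable [set x | g x <= h x].
Proof.
move=> mg mh; have := measurable_fun_ler mg mh measurableT (Y := [set true]).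
by rewrite setTI; apply.
Qed.

(* The maximal ergodic inequality, following Garsia. *)
Lemma maximal_ergodic h (X : set T) : bmeasurable h -> measurable X ->
  m (~` X) = 0 -> (forall x, X x -> exists n, 0 < birkhoff f h n x) ->
  0 <= Int h.
Proof.
move=> bh mX mX0 hX; have [mh [C hC]] := bh.
pose Z n := [set x | running_max h n x <= 0].
have bM n := bmeasurable_running_max n bh.
have mZ n : measurable (Z n).
  by case: (bM n) => mM _; apply: (@measurable_ler_set _ (fun=> 0) mM); exact: measurable_cst.
(* Outside [Z n] the difference of the running maximum at [x] and at [f x] is at most [h x]; on
   [Z n] it is nonpositive and [- C] bounds [h] from below. By invariance the difference integrates
   to 0. *)
have key n : - C * fine (m (Z n)) <= Int h.
  have -> : - C * fine (m (Z n)) =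
      Int (fun x => (running_max h n x - running_max h n (f x)) - C * \1_(Z n) x).
    rewrite IntB; last 2 first.
    - by apply: bmeasurableB; [exact: bM|exact: (bmeasurable_comp mf (bM n))].
    - exact/bmeasurableZ/bmeasurable_indic.
    rewrite IntB; last 2 first.
    - exact: bM.
    - exact: (bmeasurable_comp mf (bM n)).
    rewrite Int_comp ?subrr ?sub0r ?IntZ ?Int_indic ?mulNr//.
    exact: bmeasurable_indic.
  apply: le_Int => //.
    apply: bmeasurableB; last exact/bmeasurableZ/bmeasurable_indic.
    by apply: bmeasurableB; [exact: bM|exact: (bmeasurable_comp mf (bM n))].
  move=> x; rewrite indicE; case: (boolP (x \in Z n)) => [/set_mem|/negP] xZ.
    have /eqP -> : running_max h n x == 0 by rewrite eq_le running_max_ge0 andbT.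
    rewrite mulr1.
    have := running_max_ge0 h n (f x); have := hC x; rewrite ler_norml => /andP[+ _].
    lra.
  rewrite mulr0 subr0 lerBlDr; move: xZ; case: n => [|n].
    by rewrite inE /Z /= lexx => /(_ isT).
  move=> xZ; have pos : 0 < h x + running_max h n (f x).
    rewrite ltNge; apply/negP => le0; apply: xZ.
    by rewrite inE /Z /= ge_max lexx.
  rewrite [running_max h n.+1 x]/= (max_r (ltW pos)).
  by have := running_maxS h n (f x); lra.
have Z0 : m (\bigcap_n Z n) = 0.
  apply/eqP; rewrite eq_le measure_ge0 andbT -mX0; apply: le_measure.
  - by rewrite inE; exact: bigcapT_measurable.
  - by rewrite inE; exact: measurableC.
  move=> x Zx Xx; have [n] := hX x Xx; apply/negP; rewrite -leNgt.
  exact: le_trans (birkhoff_running_max h n x) (Zx n I).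
have cZ : (m \o Z) n @[n --> \oo] --> 0%E.
  rewrite -Z0; apply: nonincreasing_cvg_mu => //.
  - by rewrite ltey_eq fin_num_measure.
  - exact: bigcapT_measurable.
  - apply/nonincreasing_seqP => n; rewrite subsetEset => x /=.
    exact/le_trans/running_maxS.
have cfZ : fine (m (Z n)) @[n --> \oo] --> (0 : R) by exact/fine_cvg.
have : - C * fine (m (Z n)) @[n --> \oo] --> - C * 0 by exact: cvgZr.
rewrite mulr0 => cv; rewrite -(cvg_lim _ cv)//.
by apply: limr_le; [exact: cvgP cv|exact: nearW].
Qed.

Lemma measurable_orbit_product (g : T -> R) n :
  measurable_fun [set: T] g -> measurable_fun [set: T] (orbit_product f g n).
Proof.
move=> mg; elim: n => [|n IH].
  rewrite (_ : orbit_product f g 0 = cst 1); first exact: measurable_cst.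
  by apply/funext => x; rewrite /orbit_product big_ord0.
rewrite (_ : orbit_product f g n.+1 = fun x => g x * orbit_product f g n (f x)).
  by apply: measurable_funM => //; exact: (measurableT_comp IH mf).
by apply/funext => x; rewrite orbit_productS.
Qed.

Lemma measurable_hyperbolic_time (g : T -> R) s e K n :
  measurable_fun [set: T] g -> measurable (hyperbolic_time f g s e K n).
Proof.
move=> mg; rewrite (_ : hyperbolic_time f g s e K n =
  \bigcap_(k in [set k | (0 < k <= n)%N])
    ([set x | expR (k%:R * s) <= orbit_product f g k (iter (n - k) f x)] `&`
     [set x | expR (- K - k%:R * e) <= g (iter (n - k) f x)])).
  apply: bigcap_measurableType => k _; apply: measurableI.
    apply: (@measurable_ler_set (fun=> _)); first exact: measurable_cst.
    exact: (measurableT_comp (measurable_orbit_product k mg) (measurable_iter _)).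
  apply: (@measurable_ler_set (fun=> _)); first exact: measurable_cst.
  exact: (measurableT_comp mg (measurable_iter _)).
by [].
Qed.

Section truncated_logarithm.
Variables (g : T -> R) (M : R).
Hypotheses (mg : measurable_fun [set: T] g) (M0 : 0 < M).
Hypothesis g0M : forall x, 0 <= g x <= expR M.

(** The maximum is taken before the logarithm, so the default value of [ln] at 0 never enters and a
    zero of [g] receives the value [- K]. *)
Definition trunc_ln (K : R) (x : T) : R := ln (Num.max (g x) (expR (- K))).

Let max_gt0 K x : 0 < Num.max (g x) (expR (- K)).
Proof. by rewrite lt_max expR_gt0 orbT. Qed.

Lemma expR_trunc_ln K x : expR (trunc_ln K x) = Num.max (g x) (expR (- K)).
Proof. by rewrite lnK// posrE. Qed.

Lemma trunc_ln_ge K x : - K <= trunc_ln K x.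
Proof. by rewrite -ler_expR expR_trunc_ln le_max lexx orbT. Qed.

Lemma trunc_ln_le (K : R) x : 0 <= K -> trunc_ln K x <= M.
Proof.
move=> K0; rewrite -ler_expR expR_trunc_ln ge_max ler_expR.
have /andP[_ ->] := g0M x.
by rewrite /= (le_trans _ (ltW M0))// oppr_le0.
Qed.

Lemma le_trunc_ln (K K' : R) x : K <= K' -> trunc_ln K' x <= trunc_ln K x.
Proof.
move=> KK; rewrite -ler_expR !expR_trunc_ln ge_max !le_max lexx /=.
by rewrite ler_expR lerN2 KK orbT.
Qed.

Lemma bmeasurable_trunc_ln (K : R) : 0 <= K -> bmeasurable (trunc_ln K).
Proof.
move=> K0; split.
  apply: measurableT_comp; first exact: measurable_ln.
  by apply: measurable_maxr => //; exact: measurable_cst.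
exists (M + K) => x; rewrite ler_norml.
have h1 := trunc_ln_ge K x; have h2 := trunc_ln_le x K0.
by have M1 := M0; apply/andP; split; lra.
Qed.

Lemma expR_birkhoff_trunc_ln K n x :
  expR (birkhoff f (trunc_ln K) n x) =
  orbit_product f (fun y => Num.max (g y) (expR (- K))) n x.
Proof.
rewrite /birkhoff expR_sum; apply: eq_bigr => i _; exact: expR_trunc_ln.
Qed.

(** Growth at rate [s] makes some partial sum of [trunc_ln K - s / 2] positive, and the maximal
    ergodic inequality applies. That the bound does not depend on [K] is what bounds the truncated
    integrals from below. *)
Lemma Int_trunc_ln_ge (s : R) (X : set T) (K : R) : 0 <= K -> 0 < s ->
  measurable X -> m (~` X) = 0 ->
  (forall x, X x -> exists2 c : R, 0 < c & forall n0 : nat, exists2 n : nat,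
     (n0 <= n)%N & c * expR (n%:R * s) <= orbit_product f g n x) ->
  s / 2 * fine (m setT) <= Int (trunc_ln K).
Proof.
move=> K0 s0 mX mX0 hX.
have bt := bmeasurable_trunc_ln K0.
rewrite -Int_cst -subr_ge0 -IntB//; last exact: bmeasurable_cst.
apply: (maximal_ergodic _ mX mX0); first by apply: bmeasurableB => //; exact: bmeasurable_cst.
move=> x /hX[c c0 cX].
(* From this time on, [n * (s / 2)] exceeds [- ln c], so half of the exponent absorbs the
   constant. *)
have [n n0 cn] := cX (Num.truncn (- ln c / (s / 2))).+1; exists n.
have -> : birkhoff f (fun x => trunc_ln K x - s / 2) n x =
    birkhoff f (trunc_ln K) n x - n%:R * (s / 2).
  by rewrite /birkhoff sumrB sumr_const card_ord mulr_natl.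
have nc : - ln c < n%:R * (s / 2).
  rewrite -ltr_pdivrMr ?divr_gt0//.
  by rewrite (lt_le_trans (truncnS_gt _))// ler_nat.
suff : ln c + n%:R * s <= birkhoff f (trunc_ln K) n x by lra.
rewrite -ler_expR expRD lnK ?posrE// (le_trans cn)// expR_birkhoff_trunc_ln.
apply: ler_prod => i _; rewrite le_max lexx andbT.
by have /andP[] := g0M (iter i f x).
Qed.

(* A record of the partial sums of
   [trunc_ln K' - L (trunc_ln K - trunc_ln K') - s] controls both the expansion
   and the depth of the returns near the critical set, provided that [K'] is
   large enough for the truncation at [K'] to be inactive along the orbit. *)
Lemma record_hyperbolic_time (s e K K' : R) (n : nat) (x : T) :
  0 <= K -> 0 < s -> 0 < e -> K + n%:R * e < K' ->
  record f (fun y => trunc_ln K' y - M / e * (trunc_ln K y - trunc_ln K' y) - s) n x ->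
  hyperbolic_time f g s e K n x.
Proof.
move=> K0 s0 e0 KK' /recordP rec.
have L0 : 0 < M / e by rewrite divr_gt0.
have ne0 : 0 <= n%:R * e by rewrite mulr_ge0// ltW.
have KK'' : K <= K' by lra.
set z := fun k => iter (n - k) f x.
have bE k y : birkhoff f
    (fun y => trunc_ln K' y - M / e * (trunc_ln K y - trunc_ln K' y) - s) k y =
    birkhoff f (trunc_ln K') k y -
      M / e * birkhoff f (fun y => trunc_ln K y - trunc_ln K' y) k y - k%:R * s.
  rewrite /birkhoff !sumrB sumr_const card_ord.
  by rewrite -mulr_sumr sumrB mulr_natl.
have t0 y : 0 <= trunc_ln K y - trunc_ln K' y by rewrite subr_ge0 le_trunc_ln.
have B0 k y : 0 <= birkhoff f (fun y => trunc_ln K y - trunc_ln K' y) k y.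
  by apply: sumr_ge0 => i _; exact: t0.
have BM k y : birkhoff f (trunc_ln K') k y <= k%:R * M.
  have -> : k%:R * M = \sum_(i < k) M by rewrite sumr_const card_ord mulr_natl.
  by apply: ler_sum => i _; apply: trunc_ln_le; exact: le_trans KK''.
(* The sum of [trunc_ln K'] over [k] steps is at most [k M], so at a record the depths below [- K]
   add up to at most [k M / (M / e) = k e], and a single depth is bounded by their sum. *)
have deep k : (0 < k <= n)%N -> - K - k%:R * e <= trunc_ln K' (z k).
  move=> /andP[k0 kn]; have := rec k kn; rewrite -/(z k) bE => H.
  have H1 : M / e * birkhoff f (fun y => trunc_ln K y - trunc_ln K' y) k (z k)
      <= k%:R * M.
    have : 0 <= k%:R * s by rewrite mulr_ge0// ltW.
    by have := BM k (z k); lra.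
  have H2 : birkhoff f (fun y => trunc_ln K y - trunc_ln K' y) k (z k) <= k%:R * e.
    have -> : k%:R * e = k%:R * M / (M / e).
      by rewrite invf_div mulrA -(mulrA _ M) -mulrA; field; rewrite !gt_eqF.
    by rewrite ler_pdivlMr// mulrC.
  have H3 : trunc_ln K (z k) - trunc_ln K' (z k) <= k%:R * e.
    apply: le_trans H2; rewrite -(prednK k0) birkhoffSl lerDl; exact: B0.
  by have := trunc_ln_ge K (z k); lra.
(* An active truncation would give the value [- K'], which lies below [- K - k e] because [K']
   exceeds [K + n e]. *)
have inactive k : (0 < k <= n)%N -> expR (trunc_ln K' (z k)) = g (z k).
  move=> kn; have := deep k kn; rewrite expR_trunc_ln => dk.
  apply/max_l; rewrite leNgt; apply/negP => gK.
  have : expR (trunc_ln K' (z k)) = expR (- K') by rewrite expR_trunc_ln max_r// ltW.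
  move=> /expR_inj tE; move: dk; rewrite tE.
  have : k%:R * e <= n%:R * e.
    by rewrite ler_wpM2r ?(ltW e0)// ler_nat; case/andP: kn.
  by lra.
move=> k kn; split; last by rewrite -/(z k) -inactive// ler_expR deep.
have -> : orbit_product f g k (iter (n - k) f x) =
    expR (birkhoff f (trunc_ln K') k (z k)).
  rewrite /birkhoff expR_sum; apply: eq_bigr => i _.
  have -> : iter i f (z k) = z (k - i)%N.
    rewrite /z -iterD; congr iter; have := ltn_ord i; move/andP: kn; lia.
  rewrite -inactive//; have := ltn_ord i; move/andP: kn; lia.
rewrite ler_expR; case/andP: kn => _ kn; have := rec k kn; rewrite -/(z k) bE.
by have : 0 <= M / e * birkhoff f (fun y => trunc_ln K y - trunc_ln K' y) k (z k);
  [rewrite mulr_ge0// ltW|lra].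
Qed.

End truncated_logarithm.
End invariant_integrals.

(** * Positive measure of points with infinitely many hyperbolic times *)

Section frequent_hyperbolic_times.
Context d {T : measurableType d} {R : realType}
  (m : {finite_measure set T -> \bar R}) (f : T -> T).
Hypothesis mf : measurable_fun [set: T] f.
Hypothesis finv : forall A : set T, measurable A -> m (f @^-1` A) = m A.

(** If the limit superior were null, continuity from above would push the measures eventually below
    [c / 2], and their averages could not stay above [c]. *)
Lemma lim_sup_set_gt0 (E : (set T)^nat) (c : R) :
  (forall n, measurable (E n)) -> 0 < c ->
  (forall N, N%:R * c <= \sum_(n < N) fine (m (E n.+1))) ->
  (0 < m (lim_sup_set E))%E.
Proof.
move=> mE c0 hc; rewrite lt_neqAle measure_ge0 andbT eq_sym; apply/eqP => m0.
have mfin A : measurable A -> m A \is a fin_num by exact: fin_num_measure.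
have mU k : measurable (\bigcup_(j >= k) E j) by exact: bigcup_measurable.
have cvU : fine (m (\bigcup_(j >= k) E j)) @[k --> \oo] --> (0 : R).
  apply/fine_cvg; suff : m (\bigcup_(j >= k) E j) @[k --> \oo] --> 0%E by [].
  by rewrite -m0; apply: lim_sup_set_cvg => //; rewrite ltey_eq mfin.
have c20 : 0 < c / 2 by rewrite divr_gt0.
have [k _ kU] := (proj1 (cvgrPdist_lt _ _) cvU) _ c20.
set mT := fine (m setT).
have EmT A : measurable A -> fine (m A) <= mT.
  by move=> mA; apply: fine_le; rewrite ?mfin// le_measure ?inE.
have Ec j : (k <= j)%N -> fine (m (E j)) <= c / 2.
  move=> kj; apply: (@le_trans _ _ (fine (m (\bigcup_(j >= k) E j)))).
    by apply: fine_le; rewrite ?mfin// le_measure ?inE//; exact: bigcup_sup.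
  have := kU k (leqnn k); rewrite /= sub0r normrN => /ltW; apply: le_trans.
  exact: ler_norm.
have sumE N : \sum_(n < k + N) fine (m (E n.+1)) <= k%:R * mT + N%:R * (c / 2).
  elim: N => [|N IH].
    rewrite addn0 mul0r addr0.
    have -> : k%:R * mT = \sum_(n < k) mT by rewrite sumr_const card_ord mulr_natl.
    by apply: ler_sum => n _; exact: EmT.
  rewrite addnS big_ord_recr /= -natr1 mulrDl mul1r addrA lerD// Ec//.
  by rewrite (leq_trans (leq_addr N k)).
(* For this [N] the first [k] terms, at most [k mT] in total, weigh less than the gap
   [N * (c / 2)]. *)
pose N := (Num.truncn (k%:R * mT / (c / 2))).+1.
have := le_trans (hc (k + N)%N) (sumE N); rewrite natrD.
have : k%:R * mT < N%:R * (c / 2) by rewrite -ltr_pdivrMr// truncnS_gt.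
have : 0 <= k%:R * c by rewrite mulr_ge0// ltW.
lra.
Qed.

(** The integrals of the truncated logarithms are at least [s / 2] times the total mass, so beyond a
    nearly minimizing level [K0] further truncation hardly changes them and the penalty costs at
    most [s / 8]. Subtracting the drift [s / 4] leaves [s / 8], and integrating Pliss' lemma gives
    records a positive average measure. *)
Theorem hyperbolic_times (g : T -> R) (M s e : R) (X : set T) :
  measurable_fun [set: T] g -> 0 < M -> (forall x, 0 <= g x <= expR M) ->
  0 < s -> 0 < e -> measurable X -> m (~` X) = 0 -> (0 < m setT)%E ->
  (forall x, X x -> exists2 c : R, 0 < c & forall n0 : nat, exists2 n : nat,
     (n0 <= n)%N & c * expR (n%:R * s) <= orbit_product f g n x) ->
  exists2 K : R, 0 <= K &
    (0 < m (lim_sup_set (hyperbolic_time f g (s / 4) e K)))%E.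
Proof.
move=> mg M0 g0M s0 e0 mX mX0 mT0 hX.
set mT := fine (m setT).
have mT0' : 0 < mT by rewrite fine_gt0// mT0 ltey_eq fin_num_measure.
pose A K := (\int[m]_x trunc_ln g K x)%R.
have bt K : 0 <= K -> bmeasurable (trunc_ln g K) by exact: (bmeasurable_trunc_ln mg M0 g0M).
have A_ge K : 0 <= K -> s / 2 * mT <= A K.
  by move=> K0; exact: (Int_trunc_ln_ge mf finv mg M0 g0M K0 s0 mX mX0 hX).
pose dl := s / 8 * mT / (M / e).
have dl0 : 0 < dl by rewrite /dl !(divr_gt0, mulr_gt0).
have [K0 K00 hK0] : exists2 K0 : R, 0 <= K0 &
    forall K, 0 <= K -> A K0 - A K <= dl.
  pose S := [set A K | K in [set K : R | 0 <= K]].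
  have infS : has_inf S.
    split; first by exists (A 0); exists 0 => /=.
    by exists (s / 2 * mT) => _ [K K0 <-]; exact: A_ge.
  have [_ [K0 K00 <-] hlt] := inf_adherent dl0 infS.
  exists K0 => // K Kge; rewrite lerBlDr (le_trans (ltW hlt))// addrC lerD2l.
  by apply: ge_inf; [case: infS|exists K].
exists K0 => //.
pose c := s / 8 * mT / M.
have c0 : 0 < c by rewrite /c !(divr_gt0, mulr_gt0).
have mE n := @measurable_hyperbolic_time _ _ _ _ mf g (s / 4) e K0 n mg.
apply: (lim_sup_set_gt0 mE c0) => N.
(* The level [K'] depends on [N], but the hyperbolic times obtained from it involve only [K0], so
   the lower bound holds for all [N] with the same sets. *)
pose K' := K0 + N%:R * e + 1.
have Ne : 0 <= N%:R * e by rewrite mulr_ge0// ltW.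
have KK' : K0 <= K' by rewrite /K'; lra.
pose b x := trunc_ln g K' x - M / e * (trunc_ln g K0 x - trunc_ln g K' x) - s / 4.
have bK' : bmeasurable (trunc_ln g K') by apply: bt; exact: le_trans KK'.
have bK0 := bt _ K00.
have bb : bmeasurable b.
  apply: bmeasurableB; last exact: bmeasurable_cst.
  by apply: bmeasurableB => //; apply/bmeasurableZ/bmeasurableB.
have Intb : s / 8 * mT <= (\int[m]_x b x)%R.
  rewrite /b IntB; last 2 first.
  - by apply: bmeasurableB => //; apply/bmeasurableZ/bmeasurableB.
  - exact: bmeasurable_cst.
  rewrite IntB//; last by apply/bmeasurableZ/bmeasurableB.
  rewrite IntZ; last exact: bmeasurableB.
  rewrite IntB// Int_cst -/mT -/(A K') -/(A K0).
  have h1 : M / e * (A K0 - A K') <= s / 8 * mT.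
    rewrite mulrC -ler_pdivlMr ?divr_gt0//; apply: hK0; exact: le_trans KK'.
  have h2 := A_ge K' (le_trans K00 KK').
  move: (M / e * (A K0 - A K')) (A K') h1 h2 => p q.
  by clear; move: mT => y h1 h2; lra.
have bM x : b x <= M.
  have L0 : 0 <= M / e * (trunc_ln g K0 x - trunc_ln g K' x).
    by rewrite mulr_ge0 ?divr_ge0 ?(ltW M0) ?(ltW e0)// subr_ge0 le_trunc_ln.
  by have := trunc_ln_le M0 g0M x (le_trans K00 KK'); rewrite /b; lra.
have mrec n : measurable [set x | record f b n x].
  rewrite (_ : [set x | _] = \bigcap_(k in [set k | (k <= n)%N])
    [set x | birkhoff f b k x <= birkhoff f b n x]).
    apply: bigcap_measurableType => k _; apply: measurable_ler_set.
      by case: (bmeasurable_birkhoff mf k bb).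
    by case: (bmeasurable_birkhoff mf n bb).
  apply/seteqP; split => x /=.
    by move=> /forallP H k /= kn; have := H (Ordinal (kn : (k < n.+1)%N)).
  by move=> H; apply/forallP => j; apply: H => /=; rewrite -ltnS.
have recE n x : \1_[set x | record f b n x] x = (record f b n x)%:R :> R.
  by rewrite indicE mem_setE.
have : N%:R * (s / 8 * mT) <= M * \sum_(n < N) fine (m [set x | record f b n.+1 x]).
  apply: (@le_trans _ _ (\int[m]_x birkhoff f b N x)%R).
    by rewrite Int_birkhoff// ler_wpM2l.
  pose r (x : T) := \sum_(n < N) \1_[set x | record f b n.+1 x] x : R.
  have [br Ir] : bmeasurable r /\
      (\int[m]_x r x)%R = \sum_(n < N) fine (m [set x | record f b n.+1 x]).
    rewrite /r; elim: (N) => [|k [IH1 IH2]].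
      split.
        by under [X in bmeasurable X]eq_fun do rewrite big_ord0; exact: bmeasurable_cst.
      by under eq_Rintegral do rewrite big_ord0; rewrite big_ord0 Int_cst mul0r.
    under [X in bmeasurable X]eq_fun do rewrite big_ord_recr /=.
    under eq_Rintegral do rewrite big_ord_recr /=.
    have bi := @bmeasurable_indic _ _ R _ (mrec k.+1).
    split; first exact: bmeasurableD.
    by rewrite IntD// IH2 big_ord_recr /= Int_indic.
  rewrite -Ir -IntZ//; apply: le_Int => //.
  - exact: bmeasurable_birkhoff.
  - exact: bmeasurableZ.
  move=> x; apply: (le_trans (pliss f N x (ltW M0) bM)).
  by rewrite ler_wpM2l ?(ltW M0)//; apply: ler_sum => i _; rewrite recE.
move=> H; rewrite /c mulrA ler_pdivrMr// (le_trans H)// mulrC ler_wpM2r ?(ltW M0)//.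
apply: ler_sum => n _; apply: fine_le; rewrite ?fin_num_measure//.
apply: le_measure; rewrite ?inE// => x /=.
apply: (record_hyperbolic_time M0 g0M) => //; first by rewrite divr_gt0.
have : n.+1%:R * e <= N%:R * e by rewrite ler_wpM2r ?(ltW e0)// ler_nat.
by rewrite /K'; lra.
Qed.

End frequent_hyperbolic_times.

(** * Bounded distortion *)

Section bounded_distortion.
Context {R : realType}.
Variables (F g : R -> R) (H a : R).
Hypotheses (a0 : 0 < a) (H0 : 0 <= H).
Hypothesis F_linear : forall x y z w : R, 0 <= w <= 1 ->
  `|y - x| <= w -> `|z - x| <= w ->
  `|F y - F z - g x * (y - z)| <= H * w `^ a * `|y - z|.

Local Notation Dn := (orbit_product F g).

(* The interval of radius [w / (2 |Dn n x|)] around [x] stays so close to the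
   orbit of [x] that the distortions sum up to a geometric series. *)
Lemma iter_almost_linear (s e K w : R) (n : nat) (x : R) :
  0 < s -> 0 < w <= 1 -> e = s * a / 2 ->
  H * w `^ a * expR K / (1 - expR (- e)) <= 1 / 4 ->
  hyperbolic_time F (fun y => `|g y|) s e K n x ->
  forall y z : R, `|y - x| * `|Dn n x| <= w / 2 ->
    `|z - x| * `|Dn n x| <= w / 2 ->
  `|iter n F y - iter n F z - Dn n x * (y - z)| <=
    1 / 2 * `|Dn n x| * `|y - z|.
Proof.
move=> s0 /andP[w0 w1] eE HC hyp.
have a0' := a0.
have e0 : 0 < e by rewrite eE divr_gt0 ?mulr_gt0.
set q := expR (- e) in HC; set et := H * w `^ a * expR K in HC.
have q1 : 0 < 1 - q by rewrite subr_gt0 expR_lt1 oppr_lt0.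
have q0 : 0 < q by exact: expR_gt0.
have et0 : 0 <= et by rewrite /et !mulr_ge0// ?powR_ge0// expR_ge0.
set C := et / (1 - q) in HC.
have C0 : 0 <= C by rewrite divr_ge0// ltW.
have Cq : C * (1 - q) = et by rewrite divfK// gt_eqF.
set l := fun j => Dn j x.
have lS j : l j.+1 = l j * g (iter j F x) by rewrite /l /orbit_product big_ord_recr.
pose u (k : nat) := expR (- (k%:R * e)).
have uS k : u k.+1 = q * u k by rewrite /u /q -expRD -natr1; congr expR; ring.
have u0 k : 0 < u k by exact: expR_gt0.
have u1 k : u k <= 1 by rewrite /u expR_le1 oppr_le0 mulr_ge0// ltW.
have hyp' j : (j < n)%N -> expR ((n - j)%:R * s) <=
    orbit_product F (fun y => `|g y|) (n - j) (iter j F x) /\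
    expR (- K - (n - j)%:R * e) <= `|g (iter j F x)|.
  move=> jn; have jn' : (0 < n - j <= n)%N by rewrite subn_gt0 jn leq_subr.
  by have := hyp (n - j)%N jn'; rewrite subKn// ltnW.
have lge j : (j < n)%N -> expR ((n - j)%:R * s) * `|l j| <= `|l n|.
  move=> jn; have [h1 _] := hyp' j jn.
  have -> : l n = Dn (j + (n - j)) x by rewrite subnKC// ltnW.
  rewrite orbit_productD normrM mulrC ler_wpM2l// (le_trans h1)//.
  by rewrite /orbit_product normr_prod.
have gge j : (j < n)%N -> expR (- K) * u (n - j)%N <= `|g (iter j F x)|.
  move=> jn; have [_] := hyp' j jn; apply: le_trans.
  by rewrite /u -expRD ler_expR.
(* The error allowed at time [j] decays geometrically in the number [n - j] of remaining steps; at
   [j = n] it is [2 C], at most [1 / 2]. *)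
suff main j : (j <= n)%N -> forall y z : R, `|y - x| * `|l n| <= w / 2 ->
    `|z - x| * `|l n| <= w / 2 ->
    `|iter j F y - iter j F z - l j * (y - z)| <=
      2 * (C * u (n - j)%N) * `|l j| * `|y - z|.
  move=> y z hy hz; apply: (le_trans (main n (leqnn n) y z hy hz)).
  rewrite ler_wpM2r// ler_wpM2r//.
  have : C * u (n - n)%N <= C by rewrite ler_piMr.
  by lra.
elim: j => [|j IH] jn y z hy hz.
  rewrite /l /orbit_product big_ord0 mul1r subrr normr0.
  by have := mulr_ge0 C0 (ltW (u0 (n - 0)%N)); move: (C * _) => c c0; rewrite !mulr_ge0.
have := IH (ltnW jn) => {}IH.
set Y := iter j F y; set Z := iter j F z; set X := iter j F x.
set k := (n - j)%N in IH.
have kE : k = (n - j.+1).+1 by rewrite /k subnSK.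
have Cu : C * u k <= 1 / 4 by rewrite (le_trans _ HC)// ler_piMr.
have Cu0 : 0 <= C * u k by rewrite mulr_ge0// ltW.
have lip y' z' : `|y' - x| * `|l n| <= w / 2 -> `|z' - x| * `|l n| <= w / 2 ->
    `|iter j F y' - iter j F z'| <= (1 + 2 * (C * u k)) * `|l j| * `|y' - z'|.
  move=> hy' hz'; have h := IH y' z' hy' hz'.
  have := ler_normD (iter j F y' - iter j F z' - l j * (y' - z')) (l j * (y' - z')).
  by rewrite subrK normrM => /le_trans; apply; lra.
set dl := w * expR (- (k%:R * s)).
have dl0 : 0 <= dl by rewrite mulr_ge0 ?expR_ge0 ?(ltW w0).
have dl1 : dl <= 1.
  apply: (le_trans _ w1); rewrite /dl ler_piMr ?(ltW w0)// expR_le1 oppr_le0.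
  by rewrite mulr_ge0// ltW.
have close y' : `|y' - x| * `|l n| <= w / 2 -> `|iter j F y' - X| <= dl.
  move=> hy'; have hx : `|x - x| * `|l n| <= w / 2.
    by rewrite subrr normr0 mul0r divr_ge0// ltW.
  apply: (le_trans (lip y' x hy' hx)).
  have : (1 + 2 * (C * u k)) * `|l j| * `|y' - x| <= 2 * (`|l j| * `|y' - x|).
    by rewrite -mulrA ler_wpM2r ?mulr_ge0//; lra.
  move/le_trans; apply.
  have h2 : `|l j| * expR (k%:R * s) <= `|l n| by rewrite mulrC; exact: lge.
  rewrite /dl expRN ler_pdivlMr ?expR_gt0//.
  have : `|l j| * expR (k%:R * s) * `|y' - x| <= `|l n| * `|y' - x|.
    by rewrite ler_wpM2r.
  by rewrite [`|l n| * _]mulrC; nra.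
(* Since [s a = 2 e], the power of [dl] carries two factors [u k]. One of them, together with
   [expR (- K)], is absorbed by the lower bound on [g X]; the other is the summable error. *)
have dla : H * dl `^ a <= et * u k * `|g X|.
  have g1 := gge j jn; rewrite -/k -/X in g1.
  have : et * u k * (expR (- K) * u k) <= et * u k * `|g X|.
    by rewrite ler_wpM2l// mulr_ge0// ltW.
  apply: le_trans; rewrite /dl powRM ?(ltW w0) ?expR_ge0// -expRM.
  rewrite /et /u le_eqVlt; apply/orP; left; apply/eqP.
  have -> : expR (- (k%:R * s) * a) = expR (- (k%:R * e)) * expR (- (k%:R * e)).
    by rewrite -expRD eE; congr expR; field.
  have : expR K * expR (- K) = 1 by rewrite -expRD subrr expR0.
  set h := w `^ a; set v := expR (- (k%:R * e)); set p := expR K; set p' := expR (- K).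
  move=> pp; rewrite [RHS](_ : _ = (H * h * (v * v)) * (p * p')); last by ring.
  by rewrite pp mulr1 mulrA.
have st := F_linear (introT andP (conj dl0 dl1)) (close y hy) (close z hz).
rewrite !iterS -/Y -/Z lS -/X.
have -> : F Y - F Z - l j * g X * (y - z) =
  (F Y - F Z - g X * (Y - Z)) + g X * (Y - Z - l j * (y - z)) by ring.
apply: (le_trans (ler_normD _ _)); rewrite normrM.
have h1 := lip y z hy hz; rewrite -/Y -/Z in h1.
have h2 := IH y z hy hz; rewrite -/Y -/Z in h2.
have h3 : H * dl `^ a * `|Y - Z| <=
    et * u k * `|g X| * ((1 + 2 * (C * u k)) * `|l j| * `|y - z|).
  by apply: ler_pM => //; rewrite mulr_ge0// powR_ge0.
have h4 : `|g X| * `|Y - Z - l j * (y - z)| <=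
    `|g X| * (2 * (C * u k) * `|l j| * `|y - z|) by rewrite ler_wpM2l.
apply: (le_trans (lerD (le_trans st h3) h4)).
rewrite normrM.
set P := `|l j| * `|g X| * `|y - z|.
have P0 : 0 <= P by rewrite !mulr_ge0.
rewrite [leLHS](_ : _ = (et * u k * (1 + 2 * (C * u k)) + 2 * (C * u k)) * P); last first.
  by rewrite /P; ring.
rewrite [leRHS](_ : _ = 2 * (C * u (n - j.+1)%N) * P); last by rewrite /P; ring.
rewrite ler_wpM2r//.
have h5 : et * u k * (1 + 2 * (C * u k)) <= et * u k * 2.
  apply: ler_wpM2l; first by rewrite mulr_ge0// ltW.
  by lra.
apply: (@le_trans _ _ (2 * ((et + C) * u k))); first by rewrite mulrDl; lra.
(* As [et = C (1 - q)], one step replaces [C] by [q (et + C) = C (1 - (1 - q)^2)], which is at most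
   [C]. *)
rewrite ler_pM2l// kE uS mulrA ler_wpM2r ?(ltW (u0 _))//.
rewrite -Cq.
have := mulr_ge0 C0 (ltW (mulr_gt0 q1 q1)); nra.
Qed.

(** Almost linearity sends [x - r] and [x + r] to within [w / 4] of the two points at distance
    [w / 2] from the image of [x], on opposite sides; the intermediate value theorem covers what
    lies between. *)
Lemma expanding_interval (s e K w : R) (n : nat) (x : R) :
  continuous F ->
  0 < s -> 0 < w <= 1 -> e = s * a / 2 ->
  H * w `^ a * expR K / (1 - expR (- e)) <= 1 / 4 ->
  hyperbolic_time F (fun y => `|g y|) s e K n x ->
  let r := w / 2 / `|Dn n x| in
  [/\ expR (n%:R * s) <= `|Dn n x|,
      forall y z, `|y - x| <= r -> `|z - x| <= r ->
        `|iter n F y - iter n F z| <= 3 / 2 * `|Dn n x| * `|y - z| &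
      forall v, `|v - iter n F x| <= w / 4 ->
        exists2 y, `|y - x| <= r & iter n F y = v].
Proof.
move=> cF s0 w01 eE HC hyp r.
have Dge : expR (n%:R * s) <= `|Dn n x|.
  case: n hyp @r => [|n] hyp r; first by rewrite mul0r expR0 /orbit_product big_ord0 normr1.
  have [+ _] := hyp n.+1 (leqnn _); rewrite subnn /= => h; apply: (le_trans h).
  by rewrite /orbit_product normr_prod.
have D0 : 0 < `|Dn n x| by rewrite (lt_le_trans _ Dge)// expR_gt0.
have key := iter_almost_linear s0 w01 eE HC hyp.
have rE y : `|y - x| <= r -> `|y - x| * `|Dn n x| <= w / 2.
  by rewrite /r ler_pdivlMr.
have w0 : 0 < w by case/andP: w01.
have r0 : 0 <= r by rewrite /r !divr_ge0// ltW.
have rD : r * `|Dn n x| = w / 2 by rewrite /r divfK// gt_eqF.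
split=> [//|y z hy hz|v hv].
  have h := key y z (rE _ hy) (rE _ hz).
  have := ler_normD (iter n F y - iter n F z - Dn n x * (y - z)) (Dn n x * (y - z)).
  by rewrite subrK normrM => /le_trans; apply; lra.
have hx : `|x - x| * `|Dn n x| <= w / 2 by rewrite subrr normr0 mul0r divr_ge0// ltW.
have ep : x + r - x = r by ring.
have em : x - r - x = - r by ring.
have hp : `|iter n F (x + r) - iter n F x - Dn n x * r| <= w / 4.
  have := key (x + r) x; rewrite ep (ger0_norm r0) rD lexx => /(_ isT hx).
  by rewrite -mulrA [`|_| * r]mulrC rD => /le_trans; apply; lra.
have hm : `|iter n F (x - r) - iter n F x + Dn n x * r| <= w / 4.
  have := key (x - r) x; rewrite em normrN (ger0_norm r0) rD lexx => /(_ isT hx).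
  by rewrite mulrN opprK -mulrA [`|_| * r]mulrC rD => /le_trans; apply; lra.
have cn : {within `[x - r, x + r], continuous (iter n F)}.
  apply: continuous_subspaceT; elim: (n) => [|k IH] y; first exact: cvg_id.
  by apply: (continuous_comp (IH y)); exact: cF.
have xr : x - r <= x + r by lra.
suff : Num.min (iter n F (x - r)) (iter n F (x + r)) <= v <=
    Num.max (iter n F (x - r)) (iter n F (x + r)).
  move=> /(IVT xr cn)[y]; rewrite in_itv /= => /andP[y1 y2] yv.
  by exists y => //; rewrite ler_norml; apply/andP; split; lra.
rewrite ge_min le_max; move: hp hm hv; rewrite !ler_norml.
rewrite mulrC in rD.
case: (ger0P (Dn n x)) rD => D1; [|rewrite mulNr] => rD /andP[? ?] /andP[? ?] /andP[? ?].
  apply/andP; split; apply/orP; [left|right]; lra.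
apply/andP; split; apply/orP; [right|left]; lra.
Qed.

End bounded_distortion.

(** The scale is chosen before the time [n], so the images at all hyperbolic times have a common
    size. *)
Lemma small_scale {R : realType} (H a K e : R) : 0 < a -> 0 <= H -> 0 < e ->
  exists2 w : R, 0 < w <= 1 &
    H * w `^ a * expR K / (1 - expR (- e)) <= 1 / 4.
Proof.
move=> a0 H0 e0.
have q1 : 0 < 1 - expR (- e) by rewrite subr_gt0 expR_lt1 oppr_lt0.
pose B := Num.min 1 ((1 - expR (- e)) / (4 * (H + 1) * expR K)).
have H1 : 0 < H + 1 by lra.
have B0 : 0 < B by rewrite lt_min ltr01 divr_gt0// !mulr_gt0// expR_gt0.
exists (B `^ a^-1).
  rewrite powR_gt0//= -[leRHS](_ : 1 `^ a^-1 = 1); last by rewrite powR1.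
  rewrite ge0_ler_powR ?nnegrE ?invr_ge0 ?(ltW a0) ?(ltW B0)//.
  by rewrite ge_min lexx.
have -> : (B `^ a^-1) `^ a = B by rewrite -powRrM mulVf ?gt_eqF// powRr1// ltW.
rewrite ler_pdivrMr//.
have BE : B * (4 * (H + 1) * expR K) <= 1 - expR (- e).
  by rewrite -ler_pdivlMr ?mulr_gt0 ?expR_gt0// ge_min lexx orbT.
have K0 := expR_gt0 K.
have : 0 <= B * expR K by rewrite mulr_ge0// ltW.
by nra.
Qed.

(** * Lebesgue measure of images and density points *)

Section lipschitz_images.
Context {R : realType}.
Local Notation mu := (@lebesgue_measure R).

(** [lebesgue_measure] unfolds to an outer measure on all sets, so images under Lipschitz maps can
    be estimated without proving them measurable. *)
Lemma lebesgue_outer_le (A B : set R) : A `<=` B -> (mu A <= mu B)%E.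
Proof.
move=> AB; rewrite /lebesgue_measure /lebesgue_stieltjes_measure /measure_extension.
exact: le_mu_ext.
Qed.

Lemma lebesgue_itvcc (a b : R) : a <= b -> mu `[a, b]%classic = (b - a)%:E.
Proof.
move=> ab; rewrite lebesgue_measure_itv /= lte_fin -EFinB.
by move: ab; rewrite le_eqVlt => /predU1P[->|->//]; rewrite ltxx subrr.
Qed.

Lemma lebesgue_itvoo (a b : R) : a <= b -> mu `]a, b[%classic = (b - a)%:E.
Proof.
move=> ab; rewrite lebesgue_measure_itv /= lte_fin -EFinB.
by move: ab; rewrite le_eqVlt => /predU1P[->|->//]; rewrite ltxx subrr.
Qed.

(* The factor 2 is lost by covering the image of an interval by an interval
   centered at the image of one of its points. *)
Lemma lebesgue_lipschitz_image (F : R -> R) (S : set R) (L : R) : 0 < L ->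
  (forall x y, S x -> S y -> `|F x - F y| <= L * `|x - y|) ->
  (mu (F @` S) <= (2 * L)%:E * mu S)%E.
Proof.
move=> L0 FL; have L20 : 0 < 2 * L by rewrite mulr_gt0.
rewrite -lee_pdivrMl//; apply: le_ereal_inf_tmp => _ [A [mA SA] <-].
rewrite lee_pdivrMl// -nneseriesZl; last by move=> i _; exact: measure_ge0.
have cov k : exists B : set R, [/\ measurable B, F @` (S `&` A k) `<=` B &
      (mu B <= (2 * L)%:E * (wlength idfun) (A k))%E].
  have [[p [Sp Ap]]|/set0P/negP/negPn/eqP ->] := pselect ((S `&` A k) !=set0); last first.
    exists set0; split => //; first by rewrite image_set0.
    by rewrite measure0 mule_ge0// lee_fin ltW.
  have [[u v] _ uv] := mA k; rewrite -uv /= in Ap *.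
  move: Ap; rewrite in_itv /= => /andP[up pv].
  have uv' : u <= v by lra.
  exists `[F p - L * (v - u), F p + L * (v - u)]%classic; split => //.
    move=> _ [y [Sy Ay] <-]; rewrite /= in_itv /= in Ay; rewrite /= in_itv /=.
    move: Ay => /andP[uy yv].
    have h := FL y p Sy Sp.
    have : `|y - p| <= v - u by rewrite ler_norml; apply/andP; split; lra.
    move=> /(ler_wpM2l (ltW L0))/(le_trans h); rewrite ler_norml => /andP[? ?].
    by apply/andP; split; lra.
  have vu0 : 0 <= L * (v - u) by rewrite mulr_ge0 ?(ltW L0)// subr_ge0.
  rewrite lebesgue_itvcc; last by lra.
  rewrite wlength_itv /= lte_fin.
  move: uv'; rewrite le_eqVlt => /predU1P[->|uv'].
    by rewrite ltxx subrr !mulr0 subr0 addr0 subrr mule0.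
  by rewrite uv' -EFinB -EFinM lee_fin; lra.
have [B BP] := choice cov.
have mB k : measurable (B k) by case: (BP k).
have FSB : F @` S `<=` \bigcup_k B k.
  move=> _ [y Sy <-]; have [k _ Ak] := SA y Sy.
  by exists k => //; case: (BP k) => _ + _; apply; exists y.
apply: (le_trans (lebesgue_outer_le FSB)).
apply: (@le_trans _ _ (\sum_(0 <= k <oo) mu (B k))%E).
  by apply: measure_sigma_subadditive => //; exact: bigcupT_measurable.
by apply: lee_nneseries => // k _; case: (BP k).
Qed.

Lemma density_point (P : set R) : measurable P ->
  {ae mu, forall x, P x -> forall dl : R, 0 < dl ->
    exists2 r0 : R, 0 < r0 & forall r, 0 < r < r0 ->
      (mu (ball x r `\` P) <= (dl * r)%:E)%E}.
Proof.
move=> mP; have mC : measurable (~` P) by exact: measurableC.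
have := lebesgue_density mC.
apply: filter_app; first exact: (ae_filter_ringOfSetsType mu).
apply: aeW => /= x cv Px dl dl0.
have xC : \1_(~` P) x = 0 :> R by rewrite indicE memNset//; exact.
rewrite xC in cv.
have dl2 : 0 < dl / 2 by rewrite divr_gt0.
have /fine_cvgP[_ /cvgrPdist_lt /(_ _ dl2)] := cv.
rewrite near_withinE near_nbhs => -[r0 /= r00 hr].
exists r0 => // r /andP[r_gt0 rr0].
have rb : ball (0 : R) r0 r by rewrite /ball /= sub0r normrN gtr0_norm.
have r0' := ltW r_gt0.
have fin : mu (~` P `&` ball x r) \is a fin_num.
  rewrite ge0_fin_numE ?measure_ge0//.
  apply: (le_lt_trans (lebesgue_outer_le (@subIsetr _ _ (ball x r)))).
  by rewrite lebesgue_measure_ball// ltry.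
move: (hr r rb r_gt0) => {hr}; rewrite [_ `&` ball x r]setIC -setDE in fin *.
rewrite lebesgue_measure_ball// inver mulrn_eq0 (gt_eqF r_gt0) orbF.
rewrite -(fineK fin) -EFinM [fine _%:E]/= sub0r normrN => /(le_lt_trans (ler_norm _)).
rewrite lee_fin ltr_pdivrMr ?mulrn_wgt0// => /ltW/le_trans; apply.
by rewrite -mulr_natr; lra.
Qed.
End lipschitz_images.

(** * An interval of full measure from a density point *)

Section full_interval.
Context {R : realType}.
Local Notation mu := (@lebesgue_measure R).
Variables (F g : R -> R) (H a : R).
Hypotheses (a0 : 0 < a) (H0 : 0 <= H) (cF : continuous F).
Hypothesis F_linear : forall x y z w : R, 0 <= w <= 1 ->
  `|y - x| <= w -> `|z - x| <= w ->
  `|F y - F z - g x * (y - z)| <= H * w `^ a * `|y - z|.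

(** The index may vary with [dl], but half of the least measure would defeat the hypothesis if all
    were positive. This stands in for extracting a convergent subsequence of image intervals. *)
Lemma exists_null_cell (B : nat -> set R) (N : nat) :
  (forall i, (i < N)%N -> mu (B i) \is a fin_num) ->
  (forall dl : R, 0 < dl -> exists2 i, (i < N)%N & (mu (B i) <= dl%:E)%E) ->
  exists2 i, (i < N)%N & mu (B i) = 0%E.
Proof.
move=> fB hB; apply: contrapT => nB.
have pos (i : 'I_N) : 0 < fine (mu (B i)).
  rewrite fine_gt0// lt_neqAle measure_ge0 andbT ltey_eq fB// andbT eq_sym.
  by apply/eqP => Bi; apply: nB; exists i.
pose dl := \big[Num.min/1]_(i < N) fine (mu (B i)).
have dl0 : 0 < dl by apply: lt_bigmin => // i _; exact: pos.
have [i iN] := hB (dl / 2) (divr_gt0 dl0 (ltr0Sn _ _)).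
rewrite -(fineK (fB i iN)) lee_fin => h.
have : dl <= fine (mu (B (Ordinal iN))) by exact: bigmin_le.
by rewrite /=; lra.
Qed.

(** At a hyperbolic time a neighbourhood of [x] is mapped over a whole cell of a fixed partition of
    [0, 1], and the part of the cell outside [P] comes from outside [P]. Density and bounded
    distortion make that part arbitrarily small. The shift [c] brings the image of [x] back into
    [0, 1]. *)
Lemma full_interval (P : set R) (s e K : R) (x : R) :
  measurable P -> 0 < s -> e = s * a / 2 ->
  (forall dl : R, 0 < dl -> exists2 r0 : R, 0 < r0 &
    forall r, 0 < r < r0 -> (mu (ball x r `\` P) <= (dl * r)%:E)%E) ->
  (forall n0 : nat, exists2 n : nat, (n0 <= n)%N &
    hyperbolic_time F (fun y => `|g y|) s e K n x) ->
  (forall n : nat, exists2 c : R, 0 <= iter n F x - c <= 1 &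
    forall z, P z -> P (iter n F z - c)) ->
  exists u v : R, [/\ 0 <= u, u < v, v <= 1 & mu (`]u, v[ `\` P) = 0%E].
Proof.
move=> mP s0 eE dens freq shift.
have e0 : 0 < e by have := a0; rewrite eE => ?; rewrite divr_gt0 ?mulr_gt0.
have [w w01 HC] := small_scale K a0 H0 e0.
have /andP[w0 w1] := w01.
(* Cells of length at most [w / 4]: the neighbourhood covered around a point of [0, 1] contains the
   cell of that point. *)
pose N := (Num.truncn (4 / w)).+1.
have N0 : 0 < N%:R :> R by rewrite ltr0n.
have Nw : N%:R^-1 <= w / 4.
  rewrite -[w / 4]invrK lef_pV2 ?posrE ?invr_gt0 ?divr_gt0// invf_div.
  exact/ltW/truncnS_gt.
pose cell (i : nat) : set R := `]i%:R / N%:R, i.+1%:R / N%:R[%classic.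
have cell_le i : i%:R / N%:R <= i.+1%:R / N%:R :> R.
  by rewrite ler_pM2r ?invr_gt0// ler_nat.
have [||i iN cell0] := @exists_null_cell (fun i => cell i `\` P) N; last first.
- exists (i%:R / N%:R), (i.+1%:R / N%:R); split=> [|||//].
  + by rewrite divr_ge0.
  + by rewrite ltr_pM2r ?invr_gt0// ltr_nat.
  + by rewrite ler_pdivrMr// mul1r ler_nat.
- move=> dl dl0.
  (* The defect of the cell is at most [2 * (3 / 2 * D)] times [dl / 6 * (2 * r)], that is
     [dl * (r * D) = dl * (w / 2)]. *)
  have dl6 : 0 < dl / 6 by rewrite divr_gt0.
  have [r0 r00 hr0] := dens _ dl6.
  (* Late enough for the expansion [D] to exceed [w / r0], so that the radius [2 * r = w / D] is
     below [r0]. *)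
  have [n nn hyp] := freq (Num.truncn (w / r0 / s)).+1.
  have [c c01 Pc] := shift n.
  have [Dge lip cover] := expanding_interval a0 H0 F_linear cF s0 w01 eE HC hyp.
  set D := `|orbit_product F g n x| in Dge lip cover.
  set r := w / 2 / D in lip cover.
  have D0 : 0 < D by rewrite (lt_le_trans _ Dge)// expR_gt0.
  have rD : r * D = w / 2 by rewrite /r divfK// gt_eqF.
  have r_gt0 : 0 < r by rewrite /r !divr_gt0.
  have Dw : w / r0 < D.
    apply: (lt_le_trans _ Dge); apply: (@lt_le_trans _ _ (1 + n%:R * s)); last exact: expR_ge1Dx.
    have : w / r0 / s < n%:R by rewrite (lt_le_trans (truncnS_gt _))// ler_nat.
    by rewrite ltr_pdivrMr//; lra.
  have r2 : 0 < 2 * r < r0.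
    rewrite mulr_gt0//= -(ltr_pM2r D0) -mulrA rD.
    by move: Dw; rewrite ltr_pdivrMr//; lra.
  pose Phi z := iter n F z - c.
  set y := Phi x.
  pose V : set R := [set z | `|z - x| <= r].
  have Vball : V `\` P `<=` ball x (2 * r) `\` P.
    by move=> z [Vz Pz]; split => //; rewrite /ball /= distrC (le_lt_trans Vz)//; lra.
  have L0 : 0 < 3 / 2 * D by rewrite mulr_gt0.
  have lipPhi u v : (V `\` P) u -> (V `\` P) v ->
      `|Phi u - Phi v| <= 3 / 2 * D * `|u - v|.
    move=> [Vu _] [Vv _]; rewrite (le_trans _ (lip u v Vu Vv))// le_eqVlt.
    by apply/orP; left; apply/eqP; congr `|_|; rewrite /Phi; ring.
  have img := lebesgue_lipschitz_image L0 lipPhi.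
  pose i := Num.truncn (y * N%:R).
  have /andP[y0 y1] := c01; rewrite -/(Phi x) -/y in y0 y1.
  have yN : 0 <= y * N%:R by rewrite mulr_ge0.
  have /andP[i1 i2] := truncn_itv yN; rewrite -/i in i1 i2.
  (* [j = i], except that [i = N] when [y = 1] *)
  have [j jN jy] : exists2 j : nat, (j < N)%N & j%:R <= y * N%:R <= j.+1%:R.
    case: (ltnP i N) => iN; first by exists i => //; rewrite i1 ltW.
    exists N.-1; rewrite ?prednK//.
    have iN' : N%:R <= i%:R :> R by rewrite ler_nat.
    have : y * N%:R <= N%:R by rewrite ler_piMl.
    have : N.-1%:R <= N%:R :> R by rewrite ler_nat leq_pred.
    by move=> ? ?; apply/andP; split; lra.
  exists j => //.
  have sub : cell j `\` P `<=` Phi @` (V `\` P).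
    move=> v [cv Pv]; move: cv; rewrite /cell /= in_itv /=.
    rewrite ltr_pdivrMr// ltr_pdivlMr// => /andP[v1 v2].
    have vy : `|v - y| <= w / 4.
      apply: le_trans Nw; rewrite -(ler_pM2r N0) mulVf ?gt_eqF//.
      have -> : `|v - y| * N%:R = `|v * N%:R - y * N%:R|.
        by rewrite -mulrBl normrM (gtr0_norm N0).
      rewrite ler_norml.
      move: jy => /andP[j1 j2]; rewrite -natr1 in v2 j2.
      by apply/andP; split; lra.
    have [|z Vz zv] := cover (v + c).
      by rewrite (le_trans _ vy)// /y /Phi le_eqVlt; apply/orP; left; apply/eqP; congr `|_|; ring.
    exists z; last by rewrite /Phi zv addrK.
    by split => // Pz; apply: Pv; rewrite -[v](addrK c) -zv; exact: Pc.
  apply: (le_trans (lebesgue_outer_le sub)); apply: (le_trans img).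
  have h := le_trans (lebesgue_outer_le Vball) (hr0 _ r2).
  apply: (@le_trans _ _ ((2 * (3 / 2 * D))%:E * (dl / 6 * (2 * r))%:E)%E).
    by rewrite lee_pmul2l// lte_fin mulr_gt0.
  rewrite -EFinM lee_fin.
  have -> : 2 * (3 / 2 * D) * (dl / 6 * (2 * r)) = dl * (r * D) by field.
  by rewrite rD ler_piMr ?(ltW dl0)//; lra.
- move=> i _; rewrite ge0_fin_numE ?measure_ge0//.
  apply: (le_lt_trans (lebesgue_outer_le (@subDsetl _ (cell i) P))).
  by rewrite lebesgue_itvoo// ltry.
Qed.
End full_interval.

(** * Charts and lifts *)

Section affine_extension.
Context {R : realType} (I : phase_space).
Local Notation dom := (@chart_dom R I).

Definition clamp (x : R) : R :=
  if I is IntervalSpace then Num.max 0 (Num.min x 1) else x.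

Lemma clamp_dom x : dom (clamp x).
Proof.
rewrite /chart_dom /clamp; case: I => //=.
by rewrite in_itv /= le_max lexx /= ge_max ler01 ge_min lexx orbT.
Qed.

Lemma clamp_id x : dom x -> clamp x = x.
Proof.
rewrite /chart_dom /clamp; case: I => //=; rewrite in_itv /= => /andP[x0 x1].
by rewrite (min_l x1) (max_r x0).
Qed.

Lemma clamp_lipschitz x y : `|clamp x - clamp y| <= `|x - y|.
Proof.
rewrite /clamp; case: I => //.
wlog xy : x y / x <= y.
  by case: (leP x y) => [xy|/ltW xy]; [|rewrite distrC (distrC x)]; apply.
rewrite distrC (distrC x) (ger0_norm (x := y - x)) ?subr_ge0//.
case: (leP x 1) => x1; case: (leP y 1) => y1; rewrite ?maxEle ?ler01.
- by case: ifP => ?; case: ifP => ?; rewrite ler_norml; apply/andP; split; lra.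
- by case: ifP => ?; rewrite ler_norml; apply/andP; split; lra.
- by case: ifP => ?; rewrite ler_norml; apply/andP; split; lra.
- by rewrite subrr normr0 subr_ge0.
Qed.

(** The outer slopes are the one-sided derivatives at the endpoints, so the derivative is that of
    [G] composed with the 1-Lipschitz map [clamp] and inherits its Hoelder bound. On the circle this
    is [G] itself. *)
Definition extension (G : R -> R) (x : R) : R :=
  G (clamp x) + derive_in dom G (clamp x) * (x - clamp x).

Lemma extension_id G x : dom x -> extension G x = G x.
Proof. by move=> dx; rewrite /extension clamp_id// subrr mulr0 addr0. Qed.

Lemma is_derive_diff_quot (G : R -> R) (x l : R) :
  diff_quot G x @ x^' --> l -> is_derive x 1 G l.
Proof.
move=> cv.
suff D : h^-1 *: ((G \o shift x) (h *: (1 : R)) - G x) @[h --> (0:R)^'] --> l.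
  by apply: DeriveDef; [apply/cvg_ex; exists l|exact: cvg_lim].
apply/cvgrPdist_lt => e e0; move/cvgrPdist_lt : cv => /(_ e e0).
rewrite !near_withinE !near_nbhs => -[d /= d0 hd].
exists d => // h /= hd0 h0; have := hd (h + x).
rewrite /ball /= opprD addrCA subrr addr0 => /(_ _ _).
rewrite normrN; move: hd0; rewrite /ball /= sub0r normrN => /[swap] /[apply].
have hx : h + x != x by rewrite -subr_eq0 addrK.
by move=> /(_ hx); rewrite /diff_quot addrK /GRing.scale /= mulr1 [h^-1 * _]mulrC.
Qed.

Lemma diff_quot_is_derive (G : R -> R) (x l : R) :
  is_derive x 1 G l -> diff_quot G x @ x^' --> l.
Proof.
move=> [dG <-]; have : h^-1 *: ((G \o shift x) (h *: (1 : R)) - G x) @[h --> (0:R)^'] -->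
  'D_1 G x by exact: dG.
move=> cv; apply/cvgrPdist_lt => e e0; move/cvgrPdist_lt : cv => /(_ e e0).
rewrite !near_withinE !near_nbhs => -[d /= d0 hd].
exists d => // y /= xy yx; have := hd (y - x).
rewrite /ball /= sub0r opprB => /(_ xy).
rewrite subr_eq0 => /(_ yx).
by rewrite /diff_quot /GRing.scale /= mulr1 subrK [(y - x)^-1 * _]mulrC.
Qed.

Lemma is_derive_extension (G : R -> R) :
  (forall x, dom x -> derivable_in dom G x) ->
  forall x : R, is_derive x 1 (extension G) (derive_in dom G (clamp x)).
Proof.
move=> dG x; apply: is_derive_diff_quot.
have {}dG y : dom y -> diff_quot G y @ within dom y^' --> derive_in dom G y.
  exact: dG.
apply/cvgrPdist_lt => e e0.
have affine y : y != x -> clamp y = clamp x ->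
    `|derive_in dom G (clamp x) - diff_quot (extension G) x y| < e.
  move=> yx cyx; rewrite /diff_quot /extension cyx.
  rewrite [X in `|_ - X / _|](_ : _ = derive_in dom G (clamp x) * (y - x)); last by ring.
  by rewrite mulfK ?subr_eq0// subrr normr0.
have [dx|ndx] := pselect (dom x).
  have := dG x dx => /cvgrPdist_lt /(_ e e0).
  rewrite !near_withinE !near_nbhs => -[d /= d0 hd].
  have {}hd y : `|x - y| < d -> y != x -> dom y ->
      `|derive_in dom G (clamp x) - diff_quot (extension G) x y| < e.
    move=> xy yx dy; have := hd y; rewrite /ball /= => /(_ xy yx dy).
    by rewrite clamp_id// /diff_quot !extension_id.
  (* Within this radius a point outside [0, 1] can only lie beyond an endpoint equal to [x], and
     then it has the same [clamp] as [x]. *)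
  exists (Num.min d (Num.min (if x == 0 then 1 else `|x|) (if x == 1 then 1 else `|1 - x|))).
    rewrite /= !lt_min d0 /=; apply/andP; split; case: eqP => // xn.
      by rewrite normr_gt0; apply/eqP.
    by rewrite normr_gt0 subr_eq0 eq_sym; apply/eqP.
  move=> y /=; rewrite /ball /= !lt_min => /andP[xy /andP[xy0 xy1]] yx.
  have [dy|ndy] := pselect (dom y); first exact: hd.
  apply: affine => //; move: dx ndy xy0 xy1; rewrite /chart_dom /clamp.
  case: I => //=; rewrite !in_itv /= => /andP[x0 x1] /negP.
  rewrite negb_and -!ltNge => /orP[y0|y1].
    case: eqP => [-> _ _|xn]; last first.
      by rewrite (ger0_norm x0) ltr_norml => /andP[_ ?]; lra.
    by rewrite (min_l (ler01)) (min_l (ltW (lt_trans y0 ltr01))) maxxx (max_l (ltW y0)).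
  case: (x == 0) => _; case: eqP => [-> _|xn].
  - by rewrite minxx (min_r (ltW y1)).
  - by rewrite (ger0_norm (x := 1 - x)) ?subr_ge0// ltr_norml => /andP[? _]; lra.
  - by rewrite minxx (min_r (ltW y1)).
  - by rewrite (ger0_norm (x := 1 - x)) ?subr_ge0// ltr_norml => /andP[? _]; lra.
move: affine ndx; rewrite /chart_dom /clamp; case: I => //= affine.
rewrite in_itv /= => /negP; rewrite negb_and -!ltNge => /orP[x0|x1].
  rewrite near_withinE near_nbhs; exists (- x); rewrite /= ?oppr_gt0// => y /=.
  rewrite /ball /= ltr_norml => /andP[xy1 xy2] yx; apply: affine => //.
  by rewrite !(min_l _ : Num.min _ 1 = _) ?(max_l)//; lra.
rewrite near_withinE near_nbhs; exists (x - 1); rewrite /= ?subr_gt0// => y /=.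
rewrite /ball /= ltr_norml => /andP[xy1 xy2] yx; apply: affine => //.
by rewrite !min_r//; lra.
Qed.
End affine_extension.

Section charts.
Context {R : realType}.

(** Two distinct values would force an intermediate value half a unit above the smaller one. *)
Lemma continuous_int_valued_cst (h : R -> R) : continuous h ->
  (forall x, h x \is a Num.int) -> forall x y, h x = h y.
Proof.
move=> ch hint x y; wlog xy : x y / x <= y.
  by case: (leP x y) => [xy|/ltW xy] /(_ _ _ xy).
apply/eqP/negPn/negP => hxy.
have [c _ hc] : exists2 c, c \in `[x, y]%R &
    h c = Num.min (h x) (h y) + 1 / 2.
  apply: IVT => //; first exact: continuous_subspaceT.
  have [/intrP[m hm] /intrP[n hn]] := (hint x, hint y).
  have step (p q : int) : p%:~R < q%:~R :> R -> p%:~R + 1 <= q%:~R :> R.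
    by rewrite ltr_int -lezD1 -(ler_int R) rmorphD.
  have := hxy; rewrite neq_lt => /orP[] lt_h.
    rewrite (min_l (ltW lt_h)) (max_r (ltW lt_h)); move: lt_h.
    by rewrite hm hn => /step ?; apply/andP; split; lra.
  rewrite (min_r (ltW lt_h)) (max_l (ltW lt_h)); move: lt_h.
  by rewrite hm hn => /step ?; apply/andP; split; lra.
have : (1 / 2 : R) \is a Num.int.
  have -> : 1 / 2 = h c - Num.min (h x) (h y) by rewrite hc addrC addKr.
  by rewrite rpredB// /Num.min; case: ifP.
move=> /intrP[m hm].
have : (0 < m)%R by rewrite -(ltr_int R) -hm; lra.
have : (m < 1)%R by rewrite -(ltr_int R) -hm; lra.
lia.
Qed.

Lemma chart_circleP (x y : R) :
  chart CircleSpace x = chart CircleSpace y <-> x - y \is a Num.int.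
Proof.
split=> [/eqquotP//|xy].
exact/eqquotP.
Qed.

Lemma chart_interval_val (x : R) : x \in `[0, 1] ->
  val (chart IntervalSpace x : unit_interval R) = x.
Proof. by move=> x01; rewrite insubdK// inE. Qed.

Lemma chart_inj_interval (x y : R) : chart_dom IntervalSpace x ->
  chart_dom IntervalSpace y ->
  chart IntervalSpace x = chart IntervalSpace y -> x = y.
Proof.
move=> /chart_interval_val dx /chart_interval_val dy xy.
by rewrite -dx -dy xy.
Qed.

(** The difference of two representatives acts as a deck translation: an integer on the circle, 0 on
    the interval. Both phase spaces are thereby covered by one formula. *)
Lemma chart_eq_shift (I : phase_space) (x y : R) : chart_dom I x -> chart_dom I y ->
  chart I x = chart I y ->
  forall z, chart_dom I z -> chart_dom I (z - (x - y)) /\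
    chart I (z - (x - y)) = chart I z.
Proof.
case: I => [dx dy /(chart_inj_interval dx dy) -> z dz|dx dy /chart_circleP xy z _].
  by rewrite subrr subr0.
by split => //; apply/chart_circleP; rewrite addrC addKr rpredN.
Qed.

Lemma chart_unit_rep (I : phase_space) (x : R) : chart_dom I x ->
  exists2 y, 0 <= y <= 1 & chart_dom I y /\ chart I y = chart I x.
Proof.
case: I => dx; first by exists x => //; move: dx; rewrite /= in_itv.
exists (x - (Num.floor x)%:~R); last first.
  by split => //; apply/chart_circleP; rewrite addrC addKr rpredN intr_int.
have /andP[] := floor_itv x; rewrite rmorphD /= => ? ?.
by apply/andP; split; lra.
Qed.

Lemma unit_chart_dom (I : phase_space) (x : R) : 0 <= x <= 1 -> chart_dom I x.
Proof. by case: I => //= ?; rewrite in_itv. Qed.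

Lemma chart_surj (I : phase_space) (t : carrier R I) :
  exists2 x : R, 0 <= x <= 1 & chart I x = t.
Proof.
case: I t => t; last first.
  have [y y01 [_ yt]] := @chart_unit_rep CircleSpace (repr (t : {eq_quot @int_cong R})) Logic.I.
  exists y => //; rewrite yt; exact: reprK.
have /set_mem := valP (t : unit_interval R); rewrite /= in_itv /= => t01.
by exists (val (t : unit_interval R)) => //; exact: valKd.
Qed.

End charts.

Section lifts.
Context {R : realType} (I : phase_space).
Local Notation dom := (@chart_dom R I).
Local Notation ch := (@chart R I).

Lemma is_derive_continuous (F g : R -> R) :
  (forall x : R, is_derive x 1 F (g x)) -> continuous F.
Proof.
move=> dF x; apply: differentiable_continuous; apply/derivable1_diffP.
by case: (dF x).
Qed.

Section lift.
Variables (f : carrier R I -> carrier R I) (F g : R -> R).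
Hypothesis dF : forall x : R, is_derive x 1 F (g x).
Hypothesis lF : forall x, dom x -> dom (F x) /\ ch (F x) = f (ch x).

(** On the circle, [F] and its translate by the integer [u - v] differ by a continuous
    integer-valued function, hence by a constant, which differentiation removes. *)
Lemma lift_derive_periodic u v : dom u -> dom v -> ch u = ch v -> g u = g v.
Proof.
have := is_derive_continuous dF; move: lF; case: I f => f' lF' cF du dv.
  by move=> /(chart_inj_interval du dv) ->.
move=> /chart_circleP uv.
pose h z := F (z + (u - v)) - F z.
have ch' : continuous h.
  move=> z; apply: continuousB; last exact: cF.
  apply: (@continuous_comp _ _ _ (fun z => z + (u - v)) F); last exact: cF.
  by apply: continuousD; [exact: cvg_id|exact: cvg_cst].
have hint z : h z \is a Num.int.
  apply/chart_circleP; have [_ ->] := lF' (z + (u - v)) Logic.I.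
  have [_ ->] := lF' z Logic.I; congr f'; apply/chart_circleP.
  by rewrite addrC addKr.
have hc := continuous_int_valued_cst ch' hint.
have FE : F \o shift (u - v) = F + cst (h v).
  by apply/funext => z; rewrite /= fctE (hc v z) /h addrC subrK.
have uE : shift (u - v) v = u by rewrite /= addrC subrK.
have d1 : is_derive v (1 : R) (F \o shift (u - v)) (g u * 1).
  have := @is_derive1_comp R F (shift (u - v)) v (g u) 1; rewrite uE; apply.
  exact: is_derive_shift.
have d2 : is_derive v (1 : R) (F + cst (h v)) (g v + 0).
  exact: is_deriveD.
move: d1; rewrite FE => d1.
by have := @derive_val _ _ _ _ _ _ _ d1; rewrite (@derive_val _ _ _ _ _ _ _ d2) addr0 mulr1.
Qed.

Lemma iter_lift n x : dom x ->
  dom (iter n F x) /\ ch (iter n F x) = iter n f (ch x).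
Proof.
move=> dx; elim: n => [//|n [IH1 IH2]] /=.
by have [? ->] := lF IH1; rewrite IH2.
Qed.

Lemma is_derive_iter n (x : R) : is_derive x 1 (iter n F) (orbit_product F g n x).
Proof.
elim: n x => [|n IH] x.
  by rewrite /orbit_product big_ord0; exact: is_derive_id.
have -> : iter n.+1 F = F \o iter n F by [].
rewrite /orbit_product big_ord_recr /= mulrC.
exact: is_derive1_comp.
Qed.

Lemma dom_within_proper x : dom x -> ProperFilter (within dom x^').
Proof.
move=> dx; apply: Build_ProperFilter_ex => A [d /= d0 hA].
pose e := Num.min (d / 2) (1 / 2).
have e0 : 0 < e by rewrite lt_min !divr_gt0.
have d0' : 0 < d by [].
have ed : e < d by rewrite gt_min; apply/orP; left; lra.
have e1 : e <= 1 / 2 by rewrite ge_min lexx orbT.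
have [y [dy yx xy]] : exists y, [/\ dom y, y != x & `|x - y| = e].
  have [xl|xl] := leP x (1 / 2).
    exists (x + e); split.
    - move: dx; rewrite /chart_dom; case: I => //=; rewrite !in_itv /= => /andP[x0 _].
      by apply/andP; split; lra.
    - by rewrite -subr_eq0 addrC addKr gt_eqF.
    - by rewrite opprD addNKr normrN gtr0_norm.
  exists (x - e); split.
  - move: dx; rewrite /chart_dom; case: I => //=; rewrite !in_itv /= => /andP[_ x1].
    by apply/andP; split; lra.
  - by rewrite -subr_eq0 addrC addKr oppr_eq0 gt_eqF.
  - by rewrite opprB addrC subrK gtr0_norm.
by exists y; apply: hA => //=; rewrite xy.
Qed.

Lemma derive_in_is_derive (G : R -> R) (x l : R) : dom x ->
  is_derive x 1 G l -> derive_in dom G x = l.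
Proof.
move=> dx /diff_quot_is_derive cv; have pf := dom_within_proper dx.
rewrite /derive_in; apply: cvg_lim; first exact: Rhausdorff.
by apply: cvg_trans cv; apply: cvg_app; exact: cvg_within.
Qed.

(** The lift picked by [get] differs from [iter n F] by a constant on the domain, so the difference
    quotients agree, and the chain rule computes the derivative of [iter n F]. *)
Lemma abs_deriv_iter n (t : carrier R I) :
  Defs.deriv (iter n f) t = orbit_product F g n (Defs.coord t) /\ dom (Defs.coord t) /\ ch (Defs.coord t) = t.
Proof.
have [dc cE] : [set x | dom x /\ ch x = t] (Defs.coord t).
  have [x x01 xt] := chart_surj t.
  by apply: (@getPex _ [set x | dom x /\ ch x = t]); exists x; split => //; exact: unit_chart_dom.
split=> //; rewrite /Defs.deriv; set L := get _.
have cFn : continuous (iter n F) by exact: (is_derive_continuous (is_derive_iter n)).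
have [cL lL] : is_lift (iter n f) L.
  apply: (@getPex _ [set G | is_lift (iter n f) G]); exists (iter n F); split.
    exact: continuous_subspaceT.
  by move=> x dx; exact: iter_lift.
rewrite -(derive_in_is_derive dc (is_derive_iter n (Defs.coord t))).
have [c LE] : exists c, forall x, dom x -> L x = iter n F x + c.
  move: cL lL cFn (iter_lift n); rewrite {dc cE}.
  clear; case: I f L => f' L cL lL cFn lFn.
    exists 0 => x dx; rewrite addr0.
    have [d1 e1] := lL x dx; have [d2 e2] := lFn x dx.
    by apply: chart_inj_interval => //; rewrite e1 e2.
  have cL' : continuous L by exact/continuous_subspace_setT.
  have ch' : continuous (fun x => L x - iter n F x).
    by move=> x; apply: continuousB; [exact: cL'|exact: cFn].
  have hint x : L x - iter n F x \is a Num.int.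
    apply/chart_circleP; have [_ ->] := lL x Logic.I.
    by have [_ ->] := lFn x Logic.I.
  have hc := continuous_int_valued_cst ch' hint.
  by exists (L 0 - iter n F 0) => x _; rewrite (hc 0 x) addrC subrK.
rewrite /derive_in; congr lim; apply/seteqP.
have qE y : dom y -> diff_quot L (Defs.coord t) y = diff_quot (iter n F) (Defs.coord t) y.
  by move=> dy; rewrite /diff_quot !LE// opprD addrACA subrr addr0.
have dqE (G : R -> R) A : (diff_quot G (Defs.coord t) @ within dom (Defs.coord t)^') A =
    ((Defs.coord t)^' [set y | dom y -> A (diff_quot G (Defs.coord t) y)]) by [].
split=> A; rewrite !dqE; apply: filterS => y /= hy dy.
  by rewrite -qE//; exact: hy.
by rewrite qE//; exact: hy.
Qed.

End lift.
End lifts.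

(** * Hoelder continuity of the derivative *)

Section hoelder_derivative.
Context {R : realType}.

(** By the mean value theorem the error is [(g c - g x) * (y - z)] with [c] between [y] and [z],
    hence within [w] of [x]. *)
Lemma derive_hoelder_linear (F g : R -> R) (H a : R) :
  0 < a -> 0 <= H -> (forall x : R, is_derive x 1 F (g x)) ->
  (forall x y, `|x - y| <= 1 -> `|g x - g y| <= H * `|x - y| `^ a) ->
  forall x y z w : R, 0 <= w <= 1 -> `|y - x| <= w -> `|z - x| <= w ->
  `|F y - F z - g x * (y - z)| <= H * w `^ a * `|y - z|.
Proof.
move=> a0 H0 dF hg x y z w /andP[w0 w1].
have cF := is_derive_continuous dF.
wlog yz : y z / y < z.
  move=> hw hy hz; case: (ltgtP y z) => [yz|zy|->]; first exact: hw.
    have -> : F y - F z - g x * (y - z) = - (F z - F y - g x * (z - y)) by ring.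
    by rewrite normrN (distrC y z); exact: hw.
  by rewrite !subrr mulr0 subrr normr0 mulr0.
move=> hy hz; have [|c] := @MVT R F g y z yz (fun u _ => dF u); first exact: continuous_subspaceT.
rewrite in_itv /= => /andP[yc cz] FE.
have cx : `|c - x| <= w.
  by move: hy hz; rewrite !ler_norml => /andP[? ?] /andP[? ?]; apply/andP; split; lra.
have -> : F y - F z - g x * (y - z) = (g c - g x) * (y - z).
  by rewrite mulrBl -[F y - F z]opprB FE; ring.
rewrite normrM ler_wpM2r//; apply: (le_trans (hg c x (le_trans cx w1))).
by rewrite ler_wpM2l// ge0_ler_powR ?nnegrE// ltW.
Qed.

Context (I : phase_space).
Local Notation dom := (@chart_dom R I).

Lemma lipschitz_on_itv (g : R -> R) (p q : R) : p <= q ->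
  `[p, q]%classic `<=` dom ->
  (forall x, dom x -> derivable_in dom g x) ->
  {within dom, continuous (derive_in dom g)} ->
  exists2 M : R, 0 <= M & forall x y, p <= x <= q -> p <= y <= q ->
    `|g x - g y| <= M * `|x - y|.
Proof.
move=> pq sub dg cg2.
have cg2' : {within `[p, q], continuous (derive_in dom g)} by exact: continuous_subspaceW cg2.
have [u _ hu] := EVT_max pq cg2'; have [v _ hv] := EVT_min pq cg2'.
set M := `|derive_in dom g u| + `|derive_in dom g v|.
have hM c : p <= c <= q -> `|derive_in dom g c| <= M.
  move=> pcq; have := hu c; have := hv c; rewrite in_itv /= => /(_ pcq) h1 /(_ pcq) h2.
  rewrite ler_norml /M; apply/andP; split.
    rewrite (le_trans _ h1)// lerNl (le_trans (ler_norm _))// normrN lerDr//.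
  by rewrite (le_trans h2)// (le_trans (ler_norm _))// lerDl.
exists M; first by rewrite addr_ge0.
move=> x y; wlog xy : x y / x < y.
  move=> hw hx hy; case: (ltgtP x y) => [xy|yx|->]; first exact: hw.
    by rewrite distrC (distrC x); exact: hw.
  by rewrite !subrr normr0 mulr0.
move=> /andP[px xq] /andP[py yq]; have de := is_derive_extension dg.
have [|c] := @MVT R _ _ x y xy (fun c _ => de c).
  by apply: continuous_subspaceT; exact: is_derive_continuous de.
rewrite in_itv /= => /andP[xc cy].
have pcq : p <= c <= q by apply/andP; split; lra.
have din z : p <= z <= q -> dom z by move=> pz; apply: sub; rewrite /= in_itv.
rewrite !extension_id ?clamp_id; [|exact: din|apply: din; lra|apply: din; lra].
move=> E; rewrite distrC E normrM (distrC x) ler_wpM2r// hM//.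
Qed.

(** For [r < 2] the Hoelder clause of [Cr_on] gives the exponent [r - 1]. For [2 <= r] the
    derivative is continuously differentiable, hence Lipschitz on compact intervals, and on the
    circle periodicity reduces to one such interval. *)
Lemma derive_in_hoelder (r : R) (f : carrier R I -> carrier R I) (G : R -> R) :
  1 < r -> is_lift f G -> Cr_on dom r G ->
  (forall x, dom x -> derivable_in dom G x) /\
  exists a H : R, [/\ 0 < a, 0 <= H & forall x y, `|x - y| <= 1 ->
    `|derive_in dom G (clamp I x) - derive_in dom G (clamp I y)| <=
    H * `|x - y| `^ a].
Proof.
move=> r1 [cG lG] [[dG cGk] hold].
have r0 : 0 <= r by lra.
have k1 : (0 < Num.truncn r)%N by rewrite truncn_ge_nat// ltW.
have dG0 x : dom x -> derivable_in dom G x by move=> dx; exact: (dG 0%N).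
split=> //.
set g := derive_in dom G.
have [r2|r2] := leP 2 r; last first.
  have kE : Num.truncn r = 1%N by apply: truncn_def; rewrite r2 ltW.
  have rni : r \isn't a Num.int.
    apply/negP => /intrP[m mE]; have : (1 < m)%R by rewrite -(ltr_int R) -mE.
    by have : (m < 2)%R; [rewrite -(ltr_int R) -mE|lia].
  have [C hC] := hold rni; rewrite kE in hC.
  exists (r - 1), `|C|; split => //; first by lra.
  move=> x y _; apply: (le_trans (hC _ _ (clamp_dom I x) (clamp_dom I y))).
  apply: (le_trans (ler_wpM2r (powR_ge0 _ _) (ler_norm C))).
  by rewrite ler_wpM2l// ge0_ler_powR ?nnegrE ?clamp_lipschitz//; lra.
have k2 : (2 <= Num.truncn r)%N by rewrite truncn_ge_nat.
have dg x : dom x -> derivable_in dom g x by move=> dx; exact: (dG 1%N).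
have cg2 : {within dom, continuous (derive_in dom g)}.
  move: k2; rewrite leq_eqVlt => /predU1P[k2|k3].
    by move: cGk; rewrite -k2.
  have dg2 x : dom x -> derivable_in dom (derive_in dom g) x.
    by move=> dx; exact: (dG 2%N).
  apply: (@subspace_eq_continuous _ _ _ (extension I (derive_in dom g))).
    by move=> x /set_mem; exact: extension_id.
  exact/continuous_subspaceT/(is_derive_continuous (is_derive_extension dg2)).
have dF := is_derive_extension dG0.
have lF x : dom x -> dom (extension I G x) /\ chart I (extension I G x) = f (chart I x).
  by move=> dx; rewrite extension_id//; exact: lG.
have per := lift_derive_periodic dF lF.
have [p [q [pq sub red]]] : exists p q : R, [/\ p <= q, `[p, q]%classic `<=` dom &
    forall x y, `|x - y| <= 1 -> exists u v, [/\ p <= u <= q, p <= v <= q,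
      `|u - v| <= `|x - y|, g (clamp I x) = g u & g (clamp I y) = g v]].
  move: per; rewrite -/g; clear; case: I => per.
    exists 0, 1; split=> // x y xy.
    have := @clamp_dom R IntervalSpace x; have := @clamp_dom R IntervalSpace y.
    rewrite /= !in_itv /= => cy cx.
    exists (clamp IntervalSpace x), (clamp IntervalSpace y).
    by split => //; exact: clamp_lipschitz.
  (* An integer translation puts [x] in [0, 1]; then [y], at distance at most 1, lies in [-1, 2]. *)
  exists (-1), 2; split=> // [|x y]; first by lra.
  rewrite ler_norml => /andP[xy1 xy2].
  have /andP[] := floor_itv x; rewrite rmorphD /= => fl1 fl2.
  set k : R := (Num.floor x)%:~R in fl1 fl2 *.
  have kint : k \is a Num.int by exact: intr_int.
  exists (x - k), (y - k); split.
  - by apply/andP; split; lra.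
  - by apply/andP; split; lra.
  - by have -> : x - k - (y - k) = x - y by ring.
  - by apply: per => //; apply/chart_circleP; rewrite opprB addrC subrK.
  - by apply: per => //; apply/chart_circleP; rewrite opprB addrC subrK.
have [M M0 hM] := lipschitz_on_itv pq sub dg cg2.
exists 1, M; split => // x y xy; rewrite powRr1//.
have [u [v [pu pv uv -> ->]]] := red x y xy.
by apply: (le_trans (hM u v pu pv)); rewrite ler_wpM2l.
Qed.

End hoelder_derivative.

(** * Topology and Borel sets of the phase space *)

Section carrier_topology.
Context {R : realType} (I : phase_space).
Local Notation dom := (@chart_dom R I).

(** Precomposing with [clamp] avoids the junk values of [chart] and gives a map continuous on all of
    [R]. *)
Definition chart_retract (x : R) : carrier R I := chart I (clamp I x).

Lemma chart_retract_id x : dom x -> chart_retract x = chart I x.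
Proof. by move=> dx; rewrite /chart_retract clamp_id. Qed.

Lemma clamp_continuous : continuous (clamp I : R -> R).
Proof.
move=> x; apply/cvgrPdist_lt => e e0; near=> y.
apply: (le_lt_trans (clamp_lipschitz I x y)).
by near: y; exact: (proj1 (cvgrPdist_lt _ _) (@cvg_id _ (nbhs x))).
Unshelve. all: by end_near. Qed.

Lemma chart_retract_continuous : continuous chart_retract.
Proof.
have := clamp_continuous; have := clamp_dom I.
rewrite /chart_retract; case: I => cd cc.
  have cv : continuous (fun x : R => val (chart IntervalSpace (clamp IntervalSpace x) : unit_interval R)).
    rewrite (_ : (fun _ => _) = clamp IntervalSpace)//.
    by apply/funext => x; rewrite chart_interval_val// -inE; exact/mem_set/cd.
  by apply/continuous_comp_initial.
exact: pi_continuous.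
Qed.

(** Continuity can be read in the chart: on the interval [h] is [k] after the inclusion into [R],
    and the circle carries the quotient topology. *)
Lemma carrier_continuous (Z : topologicalType) (h : carrier R I -> Z) (k : R -> Z) :
  continuous k -> (forall x, dom x -> h (chart I x) = k x) -> continuous h.
Proof.
move=> ck hk; apply/continuousP => W oW; move/continuousP : ck => /(_ W oW).
move: h hk; case: I => h hk okW.
  have hv (t : unit_interval R) : h t = k (val t).
    have t01 : @chart_dom R IntervalSpace (val t) by exact: set_mem (valP t).
    by rewrite -(hk _ t01) /chart valKd.
  rewrite (_ : h @^-1` W = (fun t : unit_interval R => val t) @^-1` (k @^-1` W)).
    by apply: open_comp => // t _; exact: initial_continuous.
  by apply/funext => t /=; rewrite hv.
have : open (@circle_proj R @^-1` (h @^-1` W)); last by [].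
by rewrite (_ : _ @^-1` _ = k @^-1` W)//; apply/funext => x /=; rewrite -hk.
Qed.

Lemma open_chart_image (J : set R) : open J -> J `<=` `]0, 1[%classic ->
  open (chart I @` J).
Proof.
move=> oJ sJ; move: (I) => [].
  rewrite (_ : chart IntervalSpace @` J = (fun t : unit_interval R => val t) @^-1` J).
    by apply: open_comp => // t _; exact: initial_continuous.
  apply/seteqP; split => [_ [x Jx <-]|t Jt] /=.
    rewrite chart_interval_val//; have := sJ x Jx; rewrite /= !in_itv /= => /andP[? ?].
    by rewrite !ltW.
  by exists (val t) => //; exact: valKd.
suff : open (@circle_proj R @^-1` (chart CircleSpace @` J)) by [].
rewrite (_ : _ @^-1` _ = \bigcup_(k : int) ((fun x => x + k%:~R) @^-1` J)).
  apply: bigcup_open => k _; apply: open_comp => // x _.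
  by apply: continuousD; [exact: cvg_id|exact: cvg_cst].
apply/seteqP; split => [x [y Jy /chart_circleP/intrP[k yx]]|x [k _ Jx]].
  by exists k => //=; rewrite -yx addrC subrK.
exists (x + k%:~R) => //; apply/chart_circleP.
by rewrite addrC addKr intr_int.
Qed.

Lemma open_borel (U : set (carrier R I)) : open U -> measurable (U : set (borel R I)).
Proof. by move=> oU; exact: sub_sigma_algebra. Qed.

Lemma continuous_borel_real (h : carrier R I -> R) : continuous h ->
  measurable_fun [set: borel R I] (h : borel R I -> R).
Proof.
move=> ch; apply: (measurability _ (RGenOInfty.measurableE R)).
move=> _ [_ [x ->] <-]; rewrite setTI; apply: open_borel.
by apply: open_comp => // y _; exact: ch.
Qed.

Lemma continuous_real_borel (h : R -> carrier R I) : continuous h ->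
  measurable_fun [set: R] (h : R -> borel R I).
Proof.
move=> ch; apply: (@measurability _ _ (measurableTypeR R) (borel R I) setT h (@open (carrier R I))) => //.
move=> _ [B oB <-]; rewrite setTI; apply: open_measurable.
by apply: open_comp => // y _; exact: ch.
Qed.

Lemma continuous_borel (h : carrier R I -> carrier R I) : continuous h ->
  measurable_fun [set: borel R I] (h : borel R I -> borel R I).
Proof.
move=> ch; apply: (@measurability _ _ (borel R I) (borel R I) setT h (@open (carrier R I))) => //.
move=> _ [B oB <-]; rewrite setTI; apply: open_borel.
by apply: open_comp => // y _; exact: ch.
Qed.

End carrier_topology.

(** * Intervals filled by forward invariant sets *)

Section growth.
Context {R : realType} (I : phase_space).
Local Notation dom := (@chart_dom R I).
Local Notation ch := (@chart R I).
Variables (f : carrier R I -> carrier R I) (F g : R -> R) (H a : R).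
Hypotheses (a0 : 0 < a) (H0 : 0 <= H).
Hypothesis dF : forall x : R, is_derive x 1 F (g x).
Hypothesis hg : forall x y, `|x - y| <= 1 -> `|g x - g y| <= H * `|x - y| `^ a.
Hypothesis lF : forall x, dom x -> dom (F x) /\ ch (F x) = f (ch x).

Lemma hoelder_continuous : continuous g.
Proof.
move=> x; apply/cvgrPdist_le => e e0.
have H1 : 0 < H + 1 by have := H0; lra.
pose dl := Num.min 1 ((e / (H + 1)) `^ a^-1).
have dl0 : 0 < dl by rewrite lt_min ltr01 powR_gt0// divr_gt0.
apply/nbhs_ballP; exists dl => // y /=; rewrite /ball /= => xy.
have xy1 : `|x - y| <= 1 by rewrite (le_trans (ltW xy))// ge_min lexx.
apply: (le_trans (hg xy1)).
have : `|x - y| `^ a <= e / (H + 1).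
  have -> : e / (H + 1) = ((e / (H + 1)) `^ a^-1) `^ a.
    rewrite -powRrM mulVf ?gt_eqF// powRr1// divr_ge0//; exact: ltW.
  rewrite ge0_ler_powR ?nnegrE ?powR_ge0// ?(ltW a0)// (le_trans (ltW xy))//.
  by rewrite ge_min lexx orbT.
move=> /(ler_wpM2l H0)/le_trans; apply.
rewrite mulrCA ler_piMr ?(ltW e0)// ler_pdivrMr// mul1r; lra.
Qed.

Definition abs_deriv (t : carrier R I) : R := `|g (Defs.coord t)|.

Lemma abs_deriv_chart x : dom x -> abs_deriv (ch x) = `|g x|.
Proof.
move=> dx; have [_ [dc cx]] := abs_deriv_iter dF lF 0 (ch x).
by rewrite /abs_deriv (lift_derive_periodic dF lF dc dx).
Qed.

(** The Hoelder bound gives [|g 0| + H] on [0, 1], which is below the exponential of this quantity;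
    the added 1 makes it positive. *)
Definition deriv_bound : R := `|g 0| + H + 1.

Lemma deriv_bound_gt0 : 0 < deriv_bound.
Proof. by rewrite /deriv_bound; have := H0; have := normr_ge0 (g 0); lra. Qed.

Lemma abs_deriv_le t : 0 <= abs_deriv t <= expR deriv_bound.
Proof.
rewrite /abs_deriv normr_ge0 /=; have [x x01 <-] := chart_surj t.
rewrite -/(abs_deriv _) abs_deriv_chart; last exact: unit_chart_dom.
apply: (@le_trans _ _ (1 + deriv_bound)); last exact: expR_ge1Dx.
have /andP[x0 x1] := x01.
have x01' : `|x - 0| <= 1 by rewrite subr0 ger0_norm.
have h := hg x01'.
have h2 : H * `|x - 0| `^ a <= H.
  rewrite ler_piMr// -[leRHS](_ : 1 `^ a = 1); last by rewrite powR1.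
  by rewrite ge0_ler_powR ?nnegrE// ltW.
have := ler_normD (g x - g 0) (g 0); rewrite subrK /deriv_bound; lra.
Qed.

Lemma lift_continuous : continuous f.
Proof.
apply: (@carrier_continuous R I _ f (chart_retract I \o F)).
  move=> x; apply: continuous_comp; first exact: is_derive_continuous dF x.
  exact: chart_retract_continuous.
by move=> x dx /=; have [dFx <-] := lF dx; rewrite chart_retract_id.
Qed.

Lemma measurable_lifted : measurable_fun [set: borel R I] (f : borel R I -> borel R I).
Proof. by apply: continuous_borel; exact: lift_continuous. Qed.

Lemma measurable_abs_deriv :
  measurable_fun [set: borel R I] (abs_deriv : borel R I -> R).
Proof.
apply: continuous_borel_real; apply: (@carrier_continuous R I _ _ (fun x => `|g x|)).
  by move=> x; apply: continuous_comp; [exact: hoelder_continuous|exact: norm_continuous].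
exact: abs_deriv_chart.
Qed.

Lemma orbit_product_chart n x : dom x ->
  orbit_product f abs_deriv n (ch x) = `|orbit_product F g n x|.
Proof.
move=> dx; rewrite /orbit_product normr_prod; apply: eq_bigr => i _.
by have [di <-] := iter_lift lF i dx; rewrite abs_deriv_chart.
Qed.

Lemma hyperbolic_time_chart s e K n x : dom x ->
  hyperbolic_time f abs_deriv s e K n (ch x) ->
  hyperbolic_time F (fun y => `|g y|) s e K n x.
Proof.
move=> dx hyp k kn; have [] := hyp k kn.
have [di <-] := iter_lift lF (n - k) dx.
by rewrite orbit_product_chart// abs_deriv_chart// /orbit_product normr_prod.
Qed.

Lemma abs_deriv_iterE n t :
  `|Defs.deriv (iter n f) t| = orbit_product f abs_deriv n t.
Proof.
have [-> [dc cx]] := abs_deriv_iter dF lF n t.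
by rewrite -[in RHS]cx orbit_product_chart.
Qed.

(* The factor [c.+1%:R^-1] makes this set forward invariant. *)
Definition growth_set (s : R) : set (carrier R I) :=
  [set t | exists c : nat, forall n0 : nat, exists2 n : nat, (n0 <= n)%N &
     c.+1%:R^-1 * expR (n%:R * s) <= orbit_product f abs_deriv n t].

Lemma measurable_growth_set s : measurable (growth_set s : set (borel R I)).
Proof.
rewrite (_ : growth_set s = \bigcup_c \bigcap_n0 \bigcup_(n in [set n | (n0 <= n)%N])
   [set t : borel R I | c.+1%:R^-1 * expR (n%:R * s) <= orbit_product f abs_deriv n t]).
  apply: bigcupT_measurable => c; apply: bigcapT_measurable => n0.
  apply: bigcup_measurable => n _; apply: (@measurable_ler_set _ _ _ (fun=> _)).
    exact: measurable_cst.
  exact: (measurable_orbit_product measurable_lifted n measurable_abs_deriv).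
apply/seteqP; split => t /= [c].
  by move=> ht; exists c => // n0 _; have [n nn hn] := ht n0; exists n.
by move=> _ ht; exists c => n0; have [n nn hn] := ht n0 Logic.I; exists n.
Qed.

(** Dropping the first factor of the product multiplies the constant by at most the derivative bound
    times [expR (- s)], which a larger [c] absorbs. *)
Lemma growth_set_forward s t : growth_set s t -> growth_set s (f t).
Proof.
move=> [c ht]; pose M := expR deriv_bound.
exists (Num.truncn (M * c.+1%:R * expR (- s))) => n0.
have [[//|n] nn hn] := ht n0.+1.
exists n => //; set C := (Num.truncn _).+1%:R.
have CM : M * c.+1%:R * expR (- s) < C by exact: truncnS_gt.
have C0 : 0 < C by rewrite ltr0n.
rewrite orbit_productS in hn.
have M0 : 0 < M by exact: expR_gt0.
have c0 : 0 < c.+1%:R :> R by rewrite ltr0n.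
have D0 : 0 <= orbit_product f abs_deriv n (f t).
  by apply: prodr_ge0 => i _; exact: normr_ge0.
have hM : c.+1%:R^-1 * expR (n.+1%:R * s) <= M * orbit_product f abs_deriv n (f t).
  apply: (le_trans hn); rewrite ler_wpM2r//; by have /andP[] := abs_deriv_le t.
have : expR (n.+1%:R * s) <= c.+1%:R * M * orbit_product f abs_deriv n (f t).
  by rewrite -mulrA -ler_pdivrMl.
rewrite -natr1 mulrDl mul1r expRD => h.
rewrite ler_pdivrMl//.
have : expR (n%:R * s) <= c.+1%:R * M * orbit_product f abs_deriv n (f t) * expR (- s).
  by rewrite expRN ler_pdivlMr ?expR_gt0.
move/le_trans; apply.
rewrite -!mulrA [_ * expR (- s)]mulrC !mulrA ler_wpM2r//.
by rewrite (mulrC c.+1%:R) ltW.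
Qed.

(** A product that vanishes once vanishes at all later times, against the recurrent growth. *)
Lemma growth_set_neq0 s t n : growth_set s t -> orbit_product f abs_deriv n t != 0.
Proof.
move=> [c ht]; have [m nm hm] := ht n.
have : 0 < orbit_product f abs_deriv m t.
  by apply: lt_le_trans hm; rewrite mulr_gt0 ?expR_gt0// invr_gt0 ltr0n.
rewrite -(subnKC nm) orbit_productD => h; apply/eqP => E.
by rewrite E mul0r ltxx in h.
Qed.

Lemma lyapunov_growth_set t : (0 < lyapunov f t)%E ->
  exists k : nat, growth_set (k.+1%:R^-1) t.
Proof.
set l := lyapunov f t => l0.
have [k kl] : exists k : nat, ((k.+1%:R^-1)%:E < l)%E.
  move: l0; case: (l) => [r| |] l0; last by rewrite ltNge leNye in l0.
    rewrite lte_fin in l0; exists (Num.truncn r^-1); rewrite lte_fin invf_plt ?posrE ?ltr0n//.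
    exact: truncnS_gt.
  by exists 0%N; rewrite ltry.
exists k; exists 0%N => n0; set s := k.+1%:R^-1 in kl *.
(* The limit superior is at most the supremum over any tail; the strict inequality [n0 < n] keeps
   [n] positive. *)
have lle : (l <= ereal_sup [set ((n%:R^-1 : R)%:E * lne (`|Defs.deriv (iter n f) t|%:E))%E |
    n in [set n | (n0 < n)%N]])%E.
  apply: ereal_inf_lbound; exists [set n | (n0 < n)%N] => //.
  by exists n0.+1 => // n.
have /ereal_sup_gt[_ [n n0n <-]] := lt_le_trans kl lle.
rewrite abs_deriv_iterE; set D := orbit_product _ _ _ _ => hD.
exists n; first exact: ltnW.
have n_gt0 : 0 < n%:R :> R by rewrite ltr0n (leq_ltn_trans _ n0n).
have D0 : 0 < D.
  rewrite ltNge; apply/negP => D0; move: hD; rewrite le0_lneNy ?lee_fin//.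
  by rewrite gt0_muleNy ?lte_fin ?invr_gt0// ltNge leNye.
move: hD; rewrite lne_EFin// -EFinM lte_fin invr1 mul1r => hD.
rewrite -[leRHS](lnK (x := D)) ?posrE// ler_expR ltW//.
by rewrite mulrC -ltr_pdivlMr// mulrC.
Qed.

End growth.

(** * Intervals filled by sets of positive acim measure *)

Section acim_interval.
Context {R : realType} (I : phase_space).
Local Notation dom := (@chart_dom R I).
Local Notation ch := (@chart R I).
Local Notation leb := (@lebesgue_measure R).
Variables (f : carrier R I -> carrier R I) (F g : R -> R) (H a : R).
Hypotheses (a0 : 0 < a) (H0 : 0 <= H).
Hypothesis dF : forall x : R, is_derive x 1 F (g x).
Hypothesis hg : forall x y, `|x - y| <= 1 -> `|g x - g y| <= H * `|x - y| `^ a.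
Hypothesis lF : forall x, dom x -> dom (F x) /\ ch (F x) = f (ch x).

Lemma measurable_dom : measurable (dom : set R).
Proof. by rewrite /chart_dom; case: I => //; exact: measurable_itv. Qed.

(* A forward invariant set is invariant modulo an invariant measure. *)
Lemma forward_invariant_restriction (mu : probability (borel R I) R)
    (A B : set (borel R I)) :
  invariant_measure f mu -> measurable A -> measurable B ->
  (forall t, A t -> A (f t)) -> mu (f @^-1` B `&` A) = mu (B `&` A).
Proof.
move=> inv mA mB fA; have mf := measurable_lifted dF lF.
have mpre (C : set (borel R I)) : measurable C -> measurable (f @^-1` C : set (borel R I)).
  by move=> mC; rewrite -[X in measurable X]setTI; exact: mf.
have mfA := mpre _ mA; have mfB := mpre _ mB.
rewrite -(inv (B `&` A)); last exact: measurableI.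
have null : mu (f @^-1` A `\` A) = 0%E.
  rewrite measureD//; last by rewrite ltey_eq fin_num_measure.
  rewrite (_ : f @^-1` A `&` A = A); last by apply/setIidPr => t; exact: fA.
  by rewrite [X in (X - _)%E](inv A mA) subee// fin_num_measure.
apply/eqP; rewrite eq_le; apply/andP; split.
  apply: le_measure; rewrite ?inE.
  - exact: measurableI.
  - by apply: mpre; exact: measurableI.
  - by move=> t [Bt At]; split => //; exact: fA.
have -> : f @^-1` (B `&` A) = (f @^-1` B `&` A) `|` (f @^-1` B `&` (f @^-1` A `\` A)).
  apply/seteqP; split => t.
    move=> [Bt At]; have [tA|tA] := pselect (A t); [by left|right].
    by split.
  by move=> [[Bt At]|[Bt [fAt _]]]; split => //; exact: fA.
have m1 : measurable (f @^-1` B `&` A : set (borel R I)) by exact: measurableI.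
have m2 : measurable (f @^-1` B `&` (f @^-1` A `\` A) : set (borel R I)).
  by apply: measurableI => //; exact: measurableD.
rewrite (le_trans (measureU2 _ m1 m2))//.
rewrite [X in (_ + X)%E](_ : _ = 0%E) ?adde0//.
apply/eqP; rewrite eq_le measure_ge0 andbT -null le_measure ?inE//.
by apply: measurableD.
Qed.

Lemma acim_interval (mu : probability (borel R I) R) (A : set (borel R I)) :
  hyperbolic_acim f mu -> measurable A -> (forall t, A t -> A (f t)) ->
  (0 < mu A)%E ->
  exists P : set R, exists u v : R, [/\ measurable P,
    forall x, P x -> [/\ dom x, A (ch x) & forall n, orbit_product F g n x != 0],
    0 <= u < v, v <= 1 & leb (`]u, v[ `\` P) = 0%E].
Proof.
move=> [inv hyp ac] mA fA A0.
have mf := measurable_lifted dF lF.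
have md := measurable_abs_deriv a0 H0 dF hg lF.
have mG s := measurable_growth_set a0 H0 dF hg lF s.
(* By hyperbolicity almost every point lies in some growth set, so countable subadditivity selects
   one. *)
have [k Ak] : exists k : nat, (0 < mu (A `&` growth_set f g k.+1%:R^-1))%E.
  apply: contrapT => nk.
  have A0' k : mu (A `&` growth_set f g k.+1%:R^-1) = 0%E.
    apply/eqP; rewrite eq_le measure_ge0 andbT leNgt; apply/negP => h.
    by apply: nk; exists k.
  have mAk k : measurable (A `&` growth_set f g k.+1%:R^-1) by exact: measurableI.
  have [N [mN N0 subN]] := hyp.
  have : (mu A <= 0)%E; last by rewrite leNgt A0.
  have AU : A `<=` N `|` \bigcup_k (A `&` growth_set f g k.+1%:R^-1).
    move=> t At; have [tl|tl] := pselect (0 < lyapunov f t)%E; last by left; exact: subN.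
    by have [k hk] := lyapunov_growth_set dF lF tl; right; exists k.
  have mU : measurable (\bigcup_k (A `&` growth_set f g k.+1%:R^-1)).
    exact: bigcupT_measurable.
  apply: (@le_trans _ _ (mu (N `|` \bigcup_k (A `&` growth_set f g k.+1%:R^-1)))).
    by apply: le_measure; rewrite ?inE//; exact: measurableU.
  rewrite (le_trans (measureU2 _ mN mU))// [X in (X + _)%E]N0 add0e.
  rewrite (le_trans (measure_sigma_subadditive _ mAk mU (@subset_refl _ _)))//.
  by rewrite eseries0// => i _ _; exact: A0'.
set s := k.+1%:R^-1 in Ak; set A1 := A `&` growth_set f g s in Ak.
have s0 : 0 < s by rewrite invr_gt0 ltr0n.
have mA1 : measurable A1 by exact: measurableI.
have fA1 t : A1 t -> A1 (f t).
  by move=> [At gt]; split; [exact: fA|exact: (growth_set_forward a0 H0 dF hg lF)].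
(* The restriction to the forward invariant set [A1] is still invariant, and the growth hypothesis
   holds off an [m]-null set. *)
pose m : {finite_measure set (borel R I) -> \bar R} := mrestr mu mA1.
have minv (B : set (borel R I)) : measurable B -> m (f @^-1` B) = m B.
  by move=> mB; exact: forward_invariant_restriction.
have s40 : 0 < s / 4 by rewrite divr_gt0.
pose e := s / 4 * a / 2.
have e0 : 0 < e by have := a0; rewrite /e => ?; rewrite divr_gt0 ?mulr_gt0.
have [K K0 mE] : exists2 K : R, 0 <= K &
    (0 < m (lim_sup_set (hyperbolic_time f (abs_deriv g) (s / 4) e K)))%E.
  apply: (hyperbolic_times mf minv md (deriv_bound_gt0 g H0) _ s0 e0 mA1).
  - exact: (abs_deriv_le a0 H0 dF hg lF).
  - by rewrite /m /= /mrestr setICl measure0.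
  - by rewrite /m /= /mrestr setTI.
  - move=> t [_ [c hc]]; exists c.+1%:R^-1; first by rewrite invr_gt0 ltr0n.
    by move=> n0; have [n nn hn] := hc n0; exists n.
set E := lim_sup_set _ in mE.
have mEs : measurable (E : set (borel R I)).
  apply: bigcapT_measurable => n; apply: bigcup_measurable => j _.
  exact: (measurable_hyperbolic_time mf).
pose P : set R := dom `&` (chart_retract I @^-1` A1).
have mP : measurable P.
  apply: measurableI; first exact: measurable_dom.
  have := continuous_real_borel (@chart_retract_continuous R I).
  by move=> /(_ measurableT _ mA1); rewrite setTI.
have PE x : dom x -> P x <-> A1 (ch x).
  by move=> dx; rewrite /P /= chart_retract_id//; split=> [[]|].
have [Z [mZ Z0 densZ]] := density_point mP.
(* Otherwise the part of [E] in [A1] would be Lebesgue null, being read in [0, 1] inside the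
   exceptional set [Z], and absolute continuity would contradict [mE]. *)
have [x [x01 [Ex A1x] nZx]] : exists x, [/\ 0 <= x <= 1, (E `&` A1) (ch x) & ~ Z x].
  apply: contrapT => nx.
  have : mu (E `&` A1) = 0%E; last by move=> E0; move: mE; rewrite /m /= /mrestr E0 ltxx.
  apply: (ac (E `&` A1)) => //; last exact: measurableI.
  move=> B mB BEA; apply/eqP; rewrite eq_le measure_ge0 andbT -Z0.
  apply: lebesgue_outer_le => x [x01 Bx]; apply: contrapT => nZ; apply: nx.
  by exists x; split => //; exact: BEA.
have dx : dom x by exact: unit_chart_dom.
have Px : P x by apply/PE.
have dens : forall dl : R, 0 < dl -> exists2 r0 : R, 0 < r0 &
    forall r, 0 < r < r0 -> (leb (ball x r `\` P) <= (dl * r)%:E)%E.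
  by apply: contrapT => nd; apply: nZx; apply: densZ => /(_ Px).
have freq (n0 : nat) : exists2 n : nat, (n0 <= n)%N &
    hyperbolic_time F (fun y => `|g y|) (s / 4) e K n x.
  have [n nn hn] := Ex n0 Logic.I; exists n => //.
  exact: (hyperbolic_time_chart dF lF dx hn).
have iterA1 n t : A1 t -> A1 (iter n f t) by move=> A1t; elim: n => //= n; exact: fA1.
(* The translation by [c] carries the image of [x] to its representative in [0, 1]; it leaves charts
   unchanged, hence also membership in [P]. *)
have shift (n : nat) : exists2 c : R, 0 <= iter n F x - c <= 1 &
    forall z, P z -> P (iter n F z - c).
  have [dn cn] := iter_lift lF n dx.
  have [y y01 [dy cy]] := chart_unit_rep dn.
  exists (iter n F x - y); first by rewrite opprB addrC subrK.
  move=> z [dz]; have [dz' cz'] := iter_lift lF n dz.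
  have [d' c'] := chart_eq_shift dn dy (esym cy) dz'.
  rewrite /= chart_retract_id// => A1z; apply/PE => //.
  by rewrite c' cz'; exact: iterA1.
have [u [v [u0 uv v1 uvP]]] := full_interval a0 H0 (is_derive_continuous dF)
  (derive_hoelder_linear a0 H0 dF hg) mP s40 erefl dens freq shift.
exists P, u, v; split => //; last by rewrite u0.
move=> y Py; have dy : dom y by case: Py.
move/(PE y dy) : (Py) => [Ay gy]; split => // n.
by rewrite -normr_eq0 -(orbit_product_chart dF lF n dy); exact: (growth_set_neq0 n gy).
Qed.

End acim_interval.

(** * Transitivity against disjoint filled intervals *)

Section uniqueness.
Context {R : realType} (I : phase_space).
Local Notation dom := (@chart_dom R I).
Local Notation ch := (@chart R I).
Local Notation leb := (@lebesgue_measure R).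

Section transitivity.
Variables (f : carrier R I -> carrier R I) (F g : R -> R) (H a : R).
Hypotheses (a0 : 0 < a) (H0 : 0 <= H).
Hypothesis dF : forall x : R, is_derive x 1 F (g x).
Hypothesis hg : forall x y, `|x - y| <= 1 -> `|g x - g y| <= H * `|x - y| `^ a.
Hypothesis lF : forall x, dom x -> dom (F x) /\ ch (F x) = f (ch x).

Lemma iter_lipschitz n : exists2 L : R, 0 < L & forall x y, dom x -> dom y ->
  `|iter n F x - iter n F y| <= L * `|x - y|.
Proof.
pose L := expR (deriv_bound g H).
have lip x y : dom x -> dom y -> `|F x - F y| <= L * `|x - y|.
  wlog xy : x y / x < y.
    move=> hw dx dy; case: (ltgtP x y) => [xy|yx|->]; first exact: hw.
      by rewrite distrC (distrC x); exact: hw.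
    by rewrite !subrr normr0 mulr0.
  move=> dx dy; have [|c] := @MVT R F g x y xy (fun u _ => dF u).
    exact/continuous_subspaceT/(is_derive_continuous dF).
  rewrite in_itv /= => /andP[xc cy] E.
  have dc : dom c.
    move: dx dy; rewrite /chart_dom; case: I => //=; rewrite !in_itv /=.
    by move=> /andP[? ?] /andP[? ?]; apply/andP; split; lra.
  rewrite distrC E normrM (distrC x) ler_wpM2r//.
  rewrite -(abs_deriv_chart dF lF dc).
  by have /andP[] := abs_deriv_le a0 H0 dF hg lF (ch c).
have L0 : 0 < L by exact: expR_gt0.
elim: n => [|n [M M0 IH]]; first by exists 1 => // x y _ _; rewrite mul1r.
exists (L * M) => [|x y dx dy]; first by rewrite mulr_gt0.
have [dx' _] := iter_lift lF n dx; have [dy' _] := iter_lift lF n dy.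
rewrite /= (le_trans (lip _ _ dx' dy'))// -mulrA ler_wpM2l ?(ltW L0)//.
exact: IH.
Qed.

(** Transitivity carries a ball of the first interval into the second by a shifted iterate.
    Lipschitz maps preserve null sets, so almost every point of the image has its chart in [A]. The
    image contains a nondegenerate interval, hence would have to meet [P2]. *)
Lemma transitive_disjoint_intervals (A B : set (carrier R I)) (P1 P2 : set R)
    (u1 v1 u2 v2 : R) :
  topologically_transitive f ->
  (forall t, A t -> A (f t)) -> A `&` B = set0 ->
  measurable P1 -> measurable P2 ->
  (forall x, P1 x -> [/\ dom x, A (ch x) & forall n, orbit_product F g n x != 0]) ->
  (forall x, P2 x -> B (ch x)) ->
  0 <= u1 < v1 -> v1 <= 1 -> 0 <= u2 < v2 -> v2 <= 1 ->
  leb (`]u1, v1[ `\` P1) = 0%E -> leb (`]u2, v2[ `\` P2) = 0%E -> False.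
Proof.
move=> tr fA AB mP1 mP2 hP1 hP2 /andP[u10 uv1] v11 /andP[u20 uv2] v21 null1 null2.
have sub01 (u v : R) : 0 <= u -> v <= 1 -> `]u, v[%classic `<=` (`]0, 1[%classic : set R).
  move=> u0 v1' x /=; rewrite !in_itv /= => /andP[? ?]; apply/andP; split; lra.
have dom01 (x : R) : `]0, 1[%classic x -> dom x.
  by rewrite /= in_itv /= => /andP[? ?]; apply: unit_chart_dom; apply/andP; split; lra.
have ne (u v : R) : u < v -> (ch @` `]u, v[%classic) !=set0.
  move=> uv; exists (ch ((u + v) / 2)); exists ((u + v) / 2) => //=.
  by rewrite in_itv /=; apply/andP; split; lra.
have oc (u v : R) : 0 <= u -> v <= 1 -> open (ch @` `]u, v[%classic).
  by move=> u0 v1'; apply: open_chart_image; [exact: interval_open|exact: sub01].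
have [n [_ [[_ [x xJ <-] <-] [x' xJ' xx']]]] :=
  tr _ _ (oc _ _ u10 v11) (oc _ _ u20 v21) (ne _ _ uv1) (ne _ _ uv2).
have dx : dom x by apply: dom01; exact: (sub01 _ _ u10 v11).
have dx' : dom x' by apply: dom01; exact: (sub01 _ _ u20 v21).
have [dn cn] := iter_lift lF n dx; rewrite -cn in xx'.
have sh := chart_eq_shift dn dx' (esym xx').
set c := iter n F x - x' in sh.
pose Phi z := iter n F z - c.
have Phix : Phi x = x' by rewrite /Phi /c opprB addrC subrK.
have cFn := is_derive_continuous (is_derive_iter dF n).
have cPhi : continuous Phi.
  by move=> z; apply: continuousB; [exact: cFn|exact: cvg_cst].
have oW : open (`]u1, v1[%classic `&` Phi @^-1` `]u2, v2[%classic).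
  apply: openI; first exact: interval_open.
  by apply: open_comp => [z _|]; [exact: cPhi|exact: interval_open].
have [e /= e0 We] : exists2 e : R, 0 < e &
    ball x e `<=` `]u1, v1[%classic `&` Phi @^-1` `]u2, v2[%classic.
  have /nbhs_ballP[e e0 he] : nbhs x (`]u1, v1[%classic `&` Phi @^-1` `]u2, v2[%classic).
    by apply: open_nbhs_nbhs; split => //; split => //=; rewrite Phix.
  by exists e.
set W := ball x e in We.
have Wdom z : W z -> dom z by move=> /We[zJ _]; apply: dom01; exact: (sub01 _ _ u10 v11).
have nullW : leb (W `\` P1) = 0%E.
  apply/eqP; rewrite eq_le measure_ge0 andbT -null1; apply: lebesgue_outer_le.
  by move=> z [/We[]].
have [p Wp P1p] : exists2 p, W p & P1 p.
  apply: contrapT => np; have : (leb W <= 0)%E.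
    rewrite -nullW; apply: lebesgue_outer_le => z Wz; split => // P1z.
    by apply: np; exists z.
  by rewrite lebesgue_measure_ball ?(ltW e0)// lee_fin leNgt mulrn_wgt0.
(* The derivative of the iterate is nonzero at [p], so the image of [W] does not collapse to a
   point. *)
have [q Wq pq] : exists2 q, W q & Phi q != Phi p.
  apply: contrapT => nq; have [_ _ /(_ n) D0] := hP1 p P1p.
  have cv := diff_quot_is_derive (is_derive_iter dF n p).
  have Dpos : 0 < `|orbit_product F g n p| by rewrite normr_gt0.
  move/cvgrPdist_lt : cv => /(_ _ Dpos) n1.
  have n2 : \forall y \near p^', W y.
    apply: nbhs_dnbhs; apply: open_nbhs_nbhs; split => //.
    exact: ball_open.
  have n3 : \forall y \near p^', y != p by exact: nbhs_dnbhs_neq.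
  have [y [h1 Wy yp]] : exists y, [/\ `|orbit_product F g n p - diff_quot (iter n F) p y| <
      `|orbit_product F g n p|, W y & y != p].
    by near (p^') => y; exists y; split; near: y.
  have /eqP E : Phi y == Phi p by apply/negPn/negP => E; apply: nq; exists y.
  move: h1; rewrite /diff_quot (_ : iter n F y - iter n F p = 0) ?mul0r ?subr0 ?ltxx//.
  have -> : iter n F y - iter n F p = Phi y - Phi p by rewrite /Phi; ring.
  by rewrite E subrr.
set al := Num.min (Phi p) (Phi q); set be := Num.max (Phi p) (Phi q).
have albe : al < be.
  by rewrite /al /be; move: pq; rewrite neq_lt => /orP[h|h];
    rewrite ?(min_l (ltW h)) ?(min_r (ltW h)) ?(max_l (ltW h)) ?(max_r (ltW h)).
have img : `[al, be]%classic `<=` Phi @` W.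
  move=> w; rewrite /= in_itv /= => hw.
  have seg y z : W y -> W z -> y <= z -> Num.min (Phi y) (Phi z) <= w <= Num.max (Phi y) (Phi z) ->
      (Phi @` W) w.
    move=> Wy Wz yz hw'; have [|r] := @IVT R Phi y z w yz _ hw'.
      exact: continuous_subspaceT.
    rewrite in_itv /= => /andP[yr rz] rw; exists r => //.
    move: Wy Wz; rewrite /W /ball /= !ltr_norml => /andP[? ?] /andP[? ?].
    by apply/andP; split; lra.
  have [pq'|/ltW qp] := leP p q; first exact: (seg p q).
  by apply: (seg q p) => //; rewrite minC maxC.
have [L L0 hL] := iter_lipschitz n.
have lipPhi y z : (W `\` P1) y -> (W `\` P1) z -> `|Phi y - Phi z| <= L * `|y - z|.
  move=> [Wy _] [Wz _]; have -> : Phi y - Phi z = iter n F y - iter n F z by rewrite /Phi; ring.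
  by apply: hL; exact: Wdom.
have null3 : leb (Phi @` (W `\` P1)) = 0%E.
  apply/eqP; rewrite eq_le measure_ge0 andbT.
  by have := lebesgue_lipschitz_image L0 lipPhi; rewrite nullW mule0.
have iterA z : A z -> A (iter n f z) by move=> Az; elim: (n) => //= k; exact: fA.
(* A point reached from [P1] has its chart in [A], so disjointness keeps it out of [P2]. *)
have sub : `[al, be]%classic `\` (`]u2, v2[%classic `\` P2) `<=` Phi @` (W `\` P1).
  move=> _ [/img[z Wz <-] nz]; exists z => //; split => // P1z; apply: nz.
  have [_ zJ2] := We z Wz; split => // P2z.
  have [dz Az _] := hP1 z P1z; have [dn' cn'] := iter_lift lF n dz.
  have [_ cz] := sh _ dn'.
  suff : (A `&` B) (ch (Phi z)) by rewrite AB.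
  split; last exact: hP2.
  by rewrite /Phi cz cn'; exact: iterA.
have mN2 : measurable (`]u2, v2[%classic `\` P2) by exact: measurableD.
have : leb (`[al, be]%classic `\` (`]u2, v2[%classic `\` P2)) = (be - al)%:E.
  rewrite measureD//; last first.
    by rewrite [X in (X < _)%E](lebesgue_itvcc (ltW albe)) ltry.
  rewrite [X in (X - _)%E](lebesgue_itvcc (ltW albe)) [X in (_ - X)%E](_ : _ = 0%E) ?sube0//.
  by apply/eqP; rewrite eq_le measure_ge0 andbT -null2; exact: lebesgue_outer_le.
have := lebesgue_outer_le sub; rewrite null3 => /[swap] ->.
by rewrite lee_fin; lra.
Unshelve. all: by end_near. Qed.

End transitivity.
End uniqueness.

(** * Ergodicity and uniqueness *)

Section forward_invariant_part.
Context d {T : measurableType d} {R : realType} (f : T -> T).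
Hypothesis mf : measurable_fun [set: T] f.

Fixpoint stay (P : set T) (n : nat) : set T :=
  if n is n.+1 then P `&` f @^-1` (stay P n) else P.

Lemma measurable_stay P n : measurable P -> measurable (stay P n).
Proof.
move=> mP; elim: n => //= n IH; apply: measurableI => //.
by rewrite -[X in measurable X]setTI; exact: mf.
Qed.

(* Intersecting with [P] a preimage under [f] can only increase the difference
   of two invariant measures, as it is nonpositive outside [P]. *)
Lemma exists_forward_invariant (mu nu : probability T R) (P : set T) :
  (forall A, measurable A -> mu (f @^-1` A) = mu A) ->
  (forall A, measurable A -> nu (f @^-1` A) = nu A) ->
  measurable P -> (nu P < mu P)%E ->
  (forall E, measurable E -> E `<=` ~` P -> (mu E <= nu E)%E) ->
  exists A, [/\ measurable A, A `<=` P, forall t, A t -> A (f t) & (0 < mu A)%E].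
Proof.
move=> imu inu mP Plt hN.
have fin (m : probability T R) A : measurable A -> m A \is a fin_num by exact: fin_num_measure.
pose k A := fine (mu A) - fine (nu A).
have kP : 0 < k P.
  by rewrite /k subr_gt0 -lte_fin !fineK ?fin.
have mS n := measurable_stay n mP.
have kD A : measurable A -> k A = k (A `&` P) + k (A `\` P).
  move=> mA; have mAP : measurable (A `&` P) by exact: measurableI.
  have mDP : measurable (A `\` P) by exact: measurableD.
  have hm (m : probability T R) : fine (m A) = fine (m (A `&` P)) + fine (m (A `\` P)).
    have disj : (A `&` P) `&` (A `\` P) = set0.
      by apply/seteqP; split => // t [[_ Pt] [_ nPt]].
    have := measureU m mAP mDP disj; rewrite setUIDK => ->.
    by rewrite fineD ?fin.
  by rewrite /k !hm; ring.
have kS n : k P <= k (stay P n).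
  elim: n => //= n IH; have mpre : measurable (f @^-1` (stay P n)).
    by rewrite -[X in measurable X]setTI; exact: mf.
  have kE : k (f @^-1` stay P n) = k (stay P n).
    by rewrite /k; congr (fine _ - fine _); [exact: imu|exact: inu].
  have := kD _ mpre; rewrite kE [_ `&` P]setIC.
  have mDP : measurable (f @^-1` (stay P n) `\` P) by exact: measurableD.
  have : k (f @^-1` stay P n `\` P) <= 0.
    by rewrite /k subr_le0 fine_le ?fin// hN// => t [].
  by lra.
have decr n : stay P n.+1 `<=` stay P n.
  elim: n => [|n IH] t /=; first by case.
  by move=> [Pt St]; split => //; exact: IH.
pose A := \bigcap_n stay P n.
have mA : measurable A by exact: bigcapT_measurable.
exists A; split => //.
- by move=> t At; exact: (At 0%N).
- by move=> t At n _; have [] := At n.+1 Logic.I.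
have cv : (mu \o stay P) n @[n --> \oo] --> mu A.
  apply: nonincreasing_cvg_mu => //; first by rewrite ltey_eq fin.
  by apply/nonincreasing_seqP => n; rewrite subsetEset.
apply: (@lt_le_trans _ _ (k P)%:E); first by rewrite lte_fin.
rewrite -(cvg_lim _ cv)//; apply: lime_ge; first exact: cvgP cv.
apply: nearW => n /=; rewrite -(fineK (fin mu _ (mS n))) lee_fin.
apply: (le_trans (kS n)); rewrite /k lerBlDr lerDl fine_ge0//.
Qed.

End forward_invariant_part.

(** The positive set of a Hahn decomposition of [mu - nu] maximizes this difference, so it exceeds
    the positive value at [E]. *)
Lemma exists_excess_set d (T : measurableType d) (R : realType)
    (mu nu : probability T R) (E : set T) : measurable E -> (nu E < mu E)%E ->
  exists P, [/\ measurable P, (nu P < mu P)%E,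
    forall A, measurable A -> A `<=` P -> (nu A <= mu A)%E &
    forall A, measurable A -> A `<=` ~` P -> (mu A <= nu A)%E].
Proof.
move=> mE Elt.
have fin (m : probability T R) A : measurable A -> m A \is a fin_num by exact: fin_num_measure.
pose k := cadd (charge_of_finite_measure mu) (cscale (-1) (charge_of_finite_measure nu)).
have kE A : k A = (mu A - nu A)%E by rewrite /k /cadd /= cscaleN1.
have [P [N [[mP posP] [mN negN] PUN PIN]]] := Hahn_decomposition k.
have pos A : measurable A -> A `<=` P -> (nu A <= mu A)%E.
  move=> mA AP; have : (0 <= mu A - nu A)%E by rewrite -kE; exact: posP.
  by rewrite sube_ge0// fin.
have neg A : measurable A -> A `<=` ~` P -> (mu A <= nu A)%E.
  move=> mA AP; have : (mu A - nu A <= 0)%E; last by rewrite sube_le0.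
  rewrite -kE; apply: negN => // t At; have : [set: T] t by [].
  by rewrite -PUN => -[/(AP t At)|].
exists P; split => //; rewrite ltNge; apply/negP => Ple.
have mEP : measurable (E `&` P) by exact: measurableI.
have mED : measurable (E `\` P) by exact: measurableD.
have mPE : measurable (P `\` E) by exact: measurableD.
have mPE' : measurable (P `&` E) by exact: measurableI.
have hD (m : probability T R) X Y : measurable X -> measurable Y ->
    fine (m X) = fine (m (X `&` Y)) + fine (m (X `\` Y)).
  move=> mX mY; have mXY : measurable (X `&` Y) by exact: measurableI.
  have mDY : measurable (X `\` Y) by exact: measurableD.
  have disj : (X `&` Y) `&` (X `\` Y) = set0.
    by apply/seteqP; split => // t [[_ Pt] [_ nPt]].
  have := measureU m mXY mDY disj; rewrite setUIDK => ->.
  by rewrite fineD ?fin.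
have le1 : fine (mu (E `\` P)) <= fine (nu (E `\` P)).
  by rewrite fine_le ?fin// neg// => t [].
have le2 : fine (nu (P `\` E)) <= fine (mu (P `\` E)).
  by rewrite fine_le ?fin// pos// => t [].
have le3 : fine (mu P) <= fine (nu P) by rewrite fine_le ?fin.
have lt4 : fine (nu E) < fine (mu E) by rewrite -lte_fin !fineK ?fin.
move: le3 lt4; rewrite (hD mu P E)// (hD nu P E)// (hD mu E P)// (hD nu E P)//.
rewrite [P `&` E]setIC; lra.
Qed.

Theorem mainTheorem4 (R : realType) (I : phase_space) (r : R)
    (f : carrier R I -> carrier R I) :
  1 < r -> Cr_map r f -> topologically_transitive f ->
  (forall mu nu : probability (borel R I) R,
     hyperbolic_acim f mu -> hyperbolic_acim f nu ->
     forall A : set (borel R I), measurable A -> mu A = nu A) /\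
  (forall mu : probability (borel R I) R,
     hyperbolic_acim f mu -> ergodic f mu).
Proof.
move=> r1 [G [lG CG]] tr.
have [dG [a [H [a0 H0 hg]]]] := derive_in_hoelder r1 lG CG.
have dF := is_derive_extension dG.
have lF x : chart_dom I x -> chart_dom I (extension I G x) /\
    chart I (extension I G x) = f (chart I x).
  by case: lG => _ lG dx; rewrite extension_id//; exact: lG.
have mf := measurable_lifted dF lF.
(* Allowing two measures here serves both claims: uniqueness uses [mu] and [nu], ergodicity uses
   [mu] twice. *)
have key (mu nu : probability (borel R I) R) (A B : set (borel R I)) :
    hyperbolic_acim f mu -> hyperbolic_acim f nu ->
    measurable A -> measurable B -> A `&` B = set0 ->
    (forall t, A t -> A (f t)) -> (forall t, B t -> B (f t)) ->
    (0 < mu A)%E -> (0 < nu B)%E -> False.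
  move=> hmu hnu mA mB AB fA fB muA nuB.
  have [P1 [u1 [v1 [mP1 hP1 uv1 v11 null1]]]] := acim_interval a0 H0 dF hg lF hmu mA fA muA.
  have [P2 [u2 [v2 [mP2 hP2 uv2 v21 null2]]]] := acim_interval a0 H0 dF hg lF hnu mB fB nuB.
  have hP2' x : P2 x -> B (chart I x) by move=> /hP2[].
  exact: (transitive_disjoint_intervals a0 H0 dF hg lF tr fA AB mP1 mP2 hP1 hP2'
    uv1 v11 uv2 v21 null1 null2).
split.
- suff le_acim (mu nu : probability (borel R I) R) : hyperbolic_acim f mu ->
      hyperbolic_acim f nu -> forall A : set (borel R I), measurable A ->
      (mu A <= nu A)%E.
    by move=> mu nu hmu hnu A mA; apply/eqP; rewrite eq_le !le_acim.
  move=> hmu hnu E mE; rewrite leNgt; apply/negP => Elt.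
  have [P [mP Plt pos neg]] := exists_excess_set mE Elt.
  have [imu _ _] := hmu; have [inu _ _] := hnu.
  have [A [mA AP fA A0]] := exists_forward_invariant mf imu inu mP Plt neg.
  (* Both measures have mass 1, so [nu] exceeds [mu] on the complement of [P], and the extraction
     with exchanged roles yields a forward invariant set disjoint from [A]. *)
  have mCP : measurable (~` P) by exact: measurableC.
  have CPlt : (mu (~` P) < nu (~` P))%E.
    rewrite !probability_setC//; move: Plt.
    rewrite -(fineK (fin_num_measure mu _ mP)) -(fineK (fin_num_measure nu _ mP)).
    by rewrite -!EFinB !lte_fin; lra.
  have pos' (E' : set (borel R I)) : measurable E' -> E' `<=` ~` ~` P -> (nu E' <= mu E')%E.
    by rewrite setCK; exact: pos.
  have [B [mB BP fB B0]] := exists_forward_invariant mf inu imu mCP CPlt pos'.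
  apply: (key mu nu A B) => //.
  by apply/seteqP; split => // t [/AP + /BP].
(* An invariant set and its complement are both forward invariant, so they cannot both have positive
   measure. *)
- move=> mu hmu A mA fA.
  have [A0|A0] := eqVneq (mu A) 0%E; [by left|right].
  apply: contrapT => A1; apply: (key mu mu A (~` A)) => //.
  + exact: measurableC.
  + exact: setICr.
  + by move=> t; rewrite -{1}fA.
  + by move=> t; rewrite -{1}fA.
  + by rewrite lt_neqAle measure_ge0 eq_sym A0.
  rewrite lt_neqAle measure_ge0 andbT eq_sym; apply/eqP => C0; apply: A1.
  have := probability_setC mu mA; rewrite C0 => /esym/eqP.
  by rewrite sube_eq ?fin_num_measure// add0e => /eqP/esym.
Qed.
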